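(* For all integers $k\geq 3$ and all integers $a,b$ with $b \geq a\geq k$, we have $$ex_{b,c}(a,b,P_{2k})=ex_{b,c}(a,b,P_{2k-1}) = (k-2)(b-1) + a.$$
   Context: Graphs are finite and simple. $P_m$ denotes the path on $m$ vertices. For integers $a,b$ and a graph $H$, $ex_{b,c}(a,b,H)$ denotes the maximum number of edges in a connected bipartite graph with part sizes $a$ and $b$ that does not contain $H$ as a (not necessarily induced) subgraph. *)

(* Defs.v *)
From HB Require Import structures.
From mathcomp Require Import all_boot.

Set Implicit Arguments.
Unset Strict Implicit.
Unset Printing Implicit Defensive.

Section Graphs.

Variable T : finType.

(* A finite simple graph on T is given by its set of edges, each edge being
   an unordered pair of distinct vertices. *)
Record sgraph := SGraph {
  edges : {set {set T}};
  _ : [forall e in edges, #|e| == 2]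
}.

HB.instance Definition _ := [isSub for edges].
HB.instance Definition _ := [Finite of sgraph by <:].

Implicit Type G : sgraph.

(* Irreflexive: [set x; x] is a singleton, hence never an edge. *)
Definition adj G : rel T := fun x y => [set x; y] \in edges G.

Definition connected G : bool :=
  (0 < #|T|) && [forall x, forall y, connect (adj G) x y].

Definition bipartite_sizes (a b : nat) G : bool :=
  [exists A : {set T},
     [&& #|A| == a, #|~: A| == b &
         [forall x, forall y, adj G x y ==> ((x \in A) != (y \in A))]]].

End Graphs.

(* H is a subgraph of G, not necessarily induced. *)
Definition contains (U T : finType) (H : sgraph U) (G : sgraph T) : bool :=
  [exists f : {ffun U -> T},
     injectiveb f && [forall x, forall y, adj H x y ==> adj G (f x) (f y)]].

Definition path_edges (m : nat) : {set {set 'I_m}} :=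
  [set [set p.1; p.2] | p : 'I_m * 'I_m & p.2 == p.1.+1 :> nat].

Lemma path_edges_simple (m : nat) : [forall e in path_edges m, #|e| == 2].
Proof.
apply/forall_inP => e /imsetP[[i j]]; rewrite inE /= => /eqP ij ->.
by rewrite cards2 -val_eqE /= ij neq_ltn ltnSn.
Qed.

(* The path P_m on m vertices. *)
Definition path_graph (m : nat) : sgraph 'I_m := SGraph (path_edges_simple m).

(* A graph with parts of sizes a and b has a + b vertices, so up to
   isomorphism its vertex set is 'I_(a + b).  By convention the value is 0
   when no graph qualifies. *)
Definition ex_bc (a b : nat) (U : finType) (H : sgraph U) : nat :=
  \max_(G : sgraph 'I_(a + b)
          | [&& connected G, bipartite_sizes a b G & ~~ contains H G])
     #|edges G|.

(* Main.v *)
Require Import Defs.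
From mathcomp Require Import all_boot zify.

(** Lower bound.  Join k - 2 vertices of the class of size a to the whole other
    class and hang the remaining a - (k - 2) from one vertex of the other class.
    This graph has (k - 2) b + a - (k - 2) edges, and a path in it has at most
    2 k - 2 vertices, because its inner vertices in the first class are among
    the k - 2 vertices of large degree ([extremal_free]).

    Upper bound.  Let G be connected and bipartite, with classes A and B of
    sizes a <= b, and without a path on 2 k vertices.  The bound drops by k - 2
    when b drops by 1, and by k - 1 when a and b both drop by 1.  So it is enough
    to find, keeping G connected, a vertex of B of degree at most k - 2 when
    a < b, and a vertex of each class with degrees adding up to at most k - 1
    when a = b > k; the case a = b = k remains ([edge_bound]).

    The vertices to delete come from a longest path p.  An end of p can be
    deleted, as all its neighbours are on p.  If p has 2 t vertices, its ends are
    in different classes, and the usual rotation argument bounds the sum of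
    their degrees by t <= k - 1 ([even_ends_degree]).  If p has 2 t + 1 vertices,
    both ends are in the same class.  When this class is A, the vertices of B are
    in the majority off p, so that a depth-first search off p, started next to
    p, has a leaf x in B ([leaf_exists], [branch_exists]).  The neighbours of x
    lie on p or on the branch that leads to x; hence x can be deleted, and its
    degree and that of an end of p add up to at most t ([odd_ends_degree]).  When
    the class is B and a < b, an end of p has degree less than t
    ([first_degree_lt]); when a = b, the classes can be exchanged.

    If a = b = k, some vertices are not on p, and 2 k - 2 pairs in A x B that are
    not edges can be listed: the pairs missing at the two ends of p, and pairs
    formed by a vertex off p and a vertex that a rotation moves to an end of p
    ([nonedges_even], [nonedges_odd]).  This fails only if an odd path p contains
    a cycle through all but one of its vertices; then two vertices off the cycle
    and the successors of their neighbours on it give the pairs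
    ([nonedges_cycle]).  So G has at most k^2 - 2 k + 2 = (k - 2) (k - 1) + k
    edges. *)

Set Implicit Arguments.
Unset Strict Implicit.

(** * Longest paths, rotations and cycles *)

Section Paths.
Variables (T : finType) (e : rel T).
Implicit Types (x y z : T) (p q s C : seq T).

Definition gpath p := uniq p && sorted e p.

Definition longest p := gpath p /\ forall q, gpath q -> size q <= size p.

Lemma gpath_cat x0 s1 s2 : gpath s1 -> gpath s2 -> ~~ has (mem s1) s2 ->
  (0 < size s1 -> 0 < size s2 -> e (last x0 s1) (head x0 s2)) ->
  gpath (s1 ++ s2).
Proof.
case/andP=> u1 o1 /andP[u2 o2] dis link; rewrite /gpath cat_uniq u1 u2 dis /=.
case: s1 o1 link {u1 dis} => [|a s1] //= o1; case: s2 o2 {u2} => [|b s2] /= o2.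
  by rewrite cats0.
by rewrite cat_path o1 /= o2 => ->.
Qed.

Lemma gpath_cons x0 z p : gpath p -> z \notin p ->
  (0 < size p -> e z (head x0 p)) -> gpath (z :: p).
Proof.
move=> gp zp link; rewrite -cat1s; apply: (gpath_cat (x0 := x0)) => //.
by rewrite has_sym /= orbF.
Qed.

Lemma gpath_take i p : gpath p -> gpath (take i p).
Proof. by case/andP=> u o; rewrite /gpath take_uniq ?take_sorted. Qed.

Lemma gpath_drop i p : gpath p -> gpath (drop i p).
Proof. by case/andP=> u o; rewrite /gpath drop_uniq ?drop_sorted. Qed.

Lemma has_take_drop i j p : uniq p -> i <= j ->
  ~~ has (mem (take i p)) (drop j p).
Proof.
move=> u ij; have := cat_uniq (take i p) (drop i p).
rewrite cat_take_drop u => /esym/and3P[_ + _].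
apply: contra => /hasP[x xd xt]; apply/hasP; exists x => //.
by move: xd; rewrite -[j](subnK ij) -drop_drop => /mem_drop.
Qed.

Lemma last_take x0 i p : 0 < i <= size p -> last x0 (take i p) = nth x0 p i.-1.
Proof.
by case/andP=> i0 ip; rewrite -nth_last size_takel // nth_take // prednK.
Qed.

Lemma head_drop x0 i p : head x0 (drop i p) = nth x0 p i.
Proof. by rewrite -nth0 nth_drop addn0. Qed.

Lemma head_rev x0 s : head x0 (rev s) = last x0 s.
Proof. by case/lastP: s => [|s x] //; rewrite rev_rcons last_rcons. Qed.

Lemma last_rev x0 s : last x0 (rev s) = head x0 s.
Proof. by rewrite -[in RHS](revK s) head_rev. Qed.

Lemma head_take x0 i p : 0 < i -> head x0 (take i p) = head x0 p.
Proof. by case: i p => [|i] []. Qed.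

Lemma gpath_step x0 p i : gpath p -> i.+1 < size p ->
  e (nth x0 p i) (nth x0 p i.+1).
Proof. by case/andP=> _ /(sortedP x0); apply. Qed.

Hypothesis e_sym : symmetric e.

Lemma gpath_rev p : gpath (rev p) = gpath p.
Proof.
rewrite /gpath rev_uniq rev_sorted; congr (_ && _).
by apply: eq_sorted => x y; rewrite e_sym.
Qed.

Lemma longest_rev p : longest p -> longest (rev p).
Proof. by case=> gp lp; split; [rewrite gpath_rev | rewrite size_rev]. Qed.

(** A chord from the first vertex lets a path turn round: the initial segment is
    reversed, and the vertices at positions i, ..., j - 1 are skipped. *)
Lemma gpath_flip x0 p i j : gpath p -> i <= j -> i <= size p ->
  (0 < i -> j < size p -> e (nth x0 p 0) (nth x0 p j)) ->
  gpath (rev (take i p) ++ drop j p).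
Proof.
move=> gp ij ip link; apply: (gpath_cat (x0 := x0)).
- by rewrite gpath_rev gpath_take.
- exact: gpath_drop.
- by rewrite (eq_has (mem_rev _)) has_take_drop //; case/andP: gp.
- rewrite size_rev size_takel // size_drop subn_gt0 => i0 jp.
  by rewrite last_rev head_take // head_drop -nth0 link.
Qed.

Lemma longest_flip x0 p i : longest p -> 0 < i < size p ->
  e (nth x0 p 0) (nth x0 p i) -> longest (rev (take i p) ++ drop i p).
Proof.
move=> [gp lp] /andP[i0 ip] e0i; split.
  by apply: (gpath_flip (x0 := x0)) => //; exact: ltnW.
by move=> q gq; rewrite size_cat size_rev -size_cat cat_take_drop lp.
Qed.

Lemma longest_end x0 p z : longest p -> 0 < size p ->
  e (nth x0 p 0) z -> z \in p.
Proof.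
move=> [gp lp] p0 e0z; apply: contraT => zp.
suff /lp : gpath (z :: p) by rewrite /= ltnn.
by apply: (gpath_cons (x0 := x0)) => // _; rewrite -nth0 e_sym.
Qed.

Lemma longest_last x0 p z : longest p -> 0 < size p ->
  e (nth x0 p (size p).-1) z -> z \in p.
Proof.
move=> lp p0 elz; rewrite -mem_rev; apply: (@longest_end x0).
- exact: longest_rev.
- by rewrite size_rev.
- by rewrite nth0 head_rev -nth_last.
Qed.

(** Pósa rotation: when the first vertex is adjacent to v_i, reversing the segment
    before v_i gives another longest path, which starts at v_{i-1}; so v_{i-1}
    has no neighbour off the path. *)
Lemma longest_rotation x0 p i z : longest p -> 0 < i < size p ->
  e (nth x0 p 0) (nth x0 p i) -> e (nth x0 p i.-1) z -> z \in p.
Proof.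
move=> lp ip e0i eiz.
have: z \in rev (take i p) ++ drop i p.
  apply: (@longest_end x0); first exact: longest_flip ip e0i.
    by rewrite size_cat size_rev -size_cat cat_take_drop; case/andP: ip; case: (size p).
  case/andP: (ip) => i0 ip'.
  rewrite nth_cat size_rev size_takel ?(ltnW ip') // i0 nth0 head_rev.
  by rewrite last_take // i0 ltnW.
by rewrite mem_cat mem_rev -mem_cat cat_take_drop.
Qed.

Lemma cycle_rot C x : uniq C -> cycle e C -> x \in C ->
  exists s, [/\ perm_eq (x :: s) C, gpath (x :: s) & e (last x s) x].
Proof.
move=> uC cC xC; have [i s rC] := rot_to xC; exists s.
have pe : perm_eq (x :: s) C by rewrite -rC perm_rot.
split => //; last first.
  by move: cC; rewrite -(rot_cycle i) rC /= rcons_path => /andP[].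
rewrite /gpath (perm_uniq pe) uC /=.
by move: cC; rewrite -(rot_cycle i) rC /= rcons_path => /andP[].
Qed.

Lemma cycle_extend C x z : uniq C -> cycle e C -> x \in C -> e x z -> z \notin C ->
  exists2 q, gpath (z :: q) & perm_eq q C.
Proof.
move=> uC cC xC exz zC; have [s [pe gs _]] := cycle_rot uC cC xC.
exists (x :: s) => //; apply: (gpath_cons (x0 := x)) => //=; last by rewrite e_sym.
by rewrite (perm_mem pe).
Qed.

End Paths.

(** * Leaves of a depth-first search *)

Section DepthFirstLeaf.
Variables (T : finType) (e : rel T) (c : pred T).
Hypothesis e_sym : symmetric e.
Hypothesis e_col : forall x y, e x y -> c y = ~~ c x.
Implicit Types (S K : {set T}) (att : pred T).

Definition within S := [rel x y | [&& x \in S, y \in S & e x y]].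

Lemma within_sym S : symmetric (within S).
Proof. by move=> x y /=; rewrite e_sym andbCA. Qed.

(** The search in S may start at any vertex satisfying att, and all of S is to be
    within its reach. *)
Definition anchored S att := forall y, y \in S ->
  exists z, [/\ z \in S, att z & connect (within S) z y].

(** These counts force a depth-first search to have a leaf coloured true: if all
    leaves are coloured false, mapping each true vertex to one of its children
    is injective into the false vertices, and it misses the root if the root is
    coloured false. *)
Definition rich S att := #|S :\: [set x | c x]| < #|S :&: [set x | c x]| \/
  [/\ 0 < #|S|, forall z, z \in S -> att z -> ~~ c z &
      #|S :\: [set x | c x]| <= #|S :&: [set x | c x]|].

Lemma within_connect S z y : z \in S -> connect (within S) z y -> y \in S.
Proof.
have cl : closed (within S) S.
  by apply: intro_closed; [exact: sym_connect_sym (@within_sym S) | move=> x w /and3P[]].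
by move=> zS /(closed_connect cl) <-.
Qed.

(** The path z :: q is a branch of a depth-first search tree, so a leaf at its end
    has all its neighbours in S on the branch.  The induction follows the
    search: a component K of S that is not rich is discarded, which leaves the
    rest rich; in a rich component the start z is removed, and the search goes
    on from the neighbours of z. *)
Lemma leaf_exists n S att : #|S| <= n -> anchored S att -> rich S att ->
  exists z q, [/\ att z, gpath e (z :: q), {subset z :: q <= S},
    c (last z q) & forall y, y \in S -> e (last z q) y -> y \in z :: q].
Proof.
elim: n S att => [|n IH] S att Sn anc ri.
  have S0 : S = set0 by apply/eqP; rewrite -cards_eq0 -leqn0.
  by case: ri => [|[]]; rewrite S0 ?set0D ?set0I ?cards0.
have [y yS] : exists y, y \in S.
  apply/set0Pn; apply: contraPneq ri => ->; rewrite /rich set0D set0I !cards0.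
  by case=> // -[].
have [z [zS az _]] := anc y yS.
rewrite /rich in ri; set B := [set x | c x] in ri *.
pose K := [set y | connect (within S) z y].
have zK : z \in K by rewrite inE connect0.
have KS : K \subset S by apply/subsetP => x; rewrite inE; apply: within_connect.
have Kcl u w : u \in K -> w \in S -> e u w -> w \in K.
  move=> uK wS euw; move: (uK); rewrite !inE => /connect_trans; apply.
  by rewrite connect1 //= (subsetP KS) ?wS.
have cardA : #|S :\: B| = #|K :\: B| + #|(S :\: K) :\: B|.
  rewrite -(cardsID K (S :\: B)); congr (_ + _); apply: eq_card => x; rewrite !inE.
    have := subsetP KS x; rewrite inE; case: connect => [->|_] //=; by rewrite ?andbT ?andbF.
  by case: connect; rewrite ?andbF ?andbT.
have cardB : #|S :&: B| = #|K :&: B| + #|(S :\: K) :&: B|.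
  rewrite -(cardsID K (S :&: B)); congr (_ + _); apply: eq_card => x; rewrite !inE.
    have := subsetP KS x; rewrite inE; case: connect => [->|_] //=; by rewrite ?andbT ?andbF.
  by case: connect; rewrite ?andbF ?andbT.
have cardK : 0 < #|K| by apply/card_gt0P; exists z.
have [good|bad] := boolP ((#|K :\: B| < #|K :&: B|) ||
    ~~ c z && (#|K :\: B| <= #|K :&: B|)); last first.
  (* A component that is not rich takes away no surplus of true vertices. *)
  have [|||w [q [aw gq sq lq nq]]] := IH (S :\: K) att.
  - have := cardsID K S; rewrite (setIidPr KS); lia.
  - move=> x; rewrite inE => /andP[xK xS]; have [w [wS aw wx]] := anc x xS.
    have wK : w \notin K.
      apply: contra xK; rewrite !inE => /connect_trans; exact.
    exists w; split=> //; first by rewrite inE wK.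
    case/connectP: wx => r pr ->; apply/connectP; exists r => //.
    apply: (sub_in_path (P := [in S :\: K])) (pr) => [u v|].
      by move=> uS vS /and3P[_ _ euv] /=; rewrite uS vS.
    apply/allP => u /(path_connect pr) wu; rewrite !inE (within_connect wS wu) andbT.
    apply: contra wK => zu; rewrite inE (connect_trans zu) //.
    by rewrite (sym_connect_sym (within_sym S)).
  - move: bad; rewrite negb_or negb_and -!leqNgt -ltnNge negbK => /andP[b1 b2].
    case: ri => [ri|[_ ac ri]]; left; first by rewrite -/B; clear -ri cardA cardB b1; lia.
    by move: b2; rewrite (negbTE (ac z zS az)) -/B; clear -ri cardA cardB; lia.
  exists w, q; split => // [x /sq|x xS elx]; first by rewrite inE => /andP[].
  apply: nq => //; rewrite inE xS andbT; apply/negP => xK.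
  have /sq := mem_last w q; rewrite inE => /andP[lK lS].
  by case/negP: lK; apply: (Kcl x) => //; rewrite e_sym.
pose K' := K :\ z.
have K'n : #|K'| < #|K| by rewrite [X in _ < X](cardsD1 z) zK.
have K'A : #|K :\: B| = ~~ c z + #|K' :\: B|.
  rewrite (cardsD1 z) !inE connect0 andbT; congr (_ + _).
  by apply: eq_card => x; rewrite !inE; case: (x == z); case: (c x).
have K'B : #|K :&: B| = c z + #|K' :&: B|.
  rewrite (cardsD1 z) !inE connect0; congr (_ + _).
  by apply: eq_card => x; rewrite !inE; case: (x == z); case: (c x).
have [K0|K1] := posnP #|K'|.
  exists z, [::]; split => //=.
  - by move=> x; rewrite inE => /eqP->.
  - have K'0 : K' = set0 by apply/eqP; rewrite -cards_eq0 K0.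
    move: good; rewrite K'A K'B K'0 set0D set0I cards0; by case: (c z).
  - move=> x xS ezx; have xK := Kcl z x zK xS ezx.
    rewrite inE; apply: contraT => xz; move/eqP: K0; rewrite cards_eq0.
    by move/eqP/setP/(_ x); rewrite in_set0 in_setD1 xz xK.
have [|||w [q [ezw gq sq lq nq]]] := IH K' (e z).
- by have := subset_leq_card KS; clear -Sn K'n; lia.
- move=> x; rewrite !inE => /andP[xz /connectP[r]].
  case/shortenP => r' pr ur _ xE.
  case: r' pr ur xE => [|w r'] /=; first by move=> _ _ xE; rewrite xE eqxx in xz.
  case/andP=> /and3P[_ wS ezw] pr /andP[zr ur] xE.
  have inK : all [in K'] (w :: r').
    apply/allP => u ur'; rewrite !inE; apply/andP; split.
      by apply: contraNneq zr => <-.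
    apply: connect_trans (path_connect pr ur').
    by rewrite connect1 //= zS wS.
  exists w; split => //; first by have /andP[] := inK.
  apply/connectP; exists r' => //.
  apply: (sub_in_path (P := [in K'])) pr => // u v uK vK /and3P[_ _ euv] /=.
  by rewrite uK vK.
- move: good; rewrite K'A K'B; case cz: (c z) => /= good.
    right; split => //; last by rewrite -/B; clear -good; lia.
    by move=> x _ /e_col ->; rewrite cz.
  by left; rewrite -/B; clear -good; lia.
have sq' x : x \in w :: q -> x \in K /\ x != z.
  by move/sq; rewrite in_setD1 => /andP[].
exists z, (w :: q); split => //.
- apply: (gpath_cons (x0 := z)) => //; apply/negP => /sq' [_]; by rewrite eqxx.
- by move=> x; rewrite inE => /orP[/eqP->|/sq'[/(subsetP KS)]].
- move=> x xS /= elx; rewrite inE; have [//|xz] := eqVneq x z.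
  apply: nq => //; rewrite in_setD1 xz; apply: (Kcl (last w q)) => //.
  by have [] := sq' _ (mem_last w q).
Qed.

End DepthFirstLeaf.

(** * Connected bipartite graphs *)

Lemma card_disjoint_sub (T : finType) (A B W : {set T}) :
  A \subset W -> B \subset W -> (forall x, x \in A -> x \in B -> False) ->
  #|A| + #|B| <= #|W|.
Proof.
move=> AW BW dis; have /eqP <- : #|A :|: B| == #|A| + #|B|.
  rewrite (leq_card_setU A B) -setI_eq0; apply/eqP/setP => x.
  by rewrite !inE; apply/negbTE/negP => /andP[/dis].
by apply: subset_leq_card; rewrite subUset AW.
Qed.

Lemma head_cat (T : Type) (x0 : T) s1 s2 :
  0 < size s1 -> head x0 (s1 ++ s2) = head x0 s1.
Proof. by case: s1. Qed.

Lemma last_in (T : eqType) (x0 : T) s : 0 < size s -> last x0 s \in s.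
Proof. by case: s => //= x s _; rewrite mem_last. Qed.

(** A connected bipartite graph on V whose classes are cut out by the Boolean
    colour c.  The vertex set varies inside a fixed type, so that deleting
    vertices keeps the type; the field bip_in makes e void off V. *)
Record bipgraph (T : finType) (V : {set T}) (e : rel T) (c : pred T) : Prop :=
  BipGraph {
    bip_sym : symmetric e;
    bip_col : forall x y, e x y -> c y = ~~ c x;
    bip_in : forall x y, e x y -> x \in V;
    bip_conn : {in V &, forall x y, connect e x y} }.

Section Bipartite.
Variables (T : finType) (V : {set T}) (e : rel T) (c : pred T).
Hypothesis G : bipgraph V e c.
Implicit Types (x y z : T) (p q s C : seq T).

Definition nbr x := [set y | e x y].

Let e_sym := bip_sym G.
Let e_col := bip_col G.

Lemma closed_all (P : pred T) x : x \in V -> P x ->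
  (forall y z, e y z -> P y -> P z) -> forall y, y \in V -> P y.
Proof.
move=> xV Px cl y yV; have := bip_conn G xV yV.
have cP : closed e P by apply: intro_closed => //; apply: sym_connect_sym.
by move/(closed_connect cP); rewrite -[y \in P]/(P y) => <-.
Qed.

Lemma path_colour x0 p i : gpath e p -> i < size p ->
  c (nth x0 p i) = c (nth x0 p 0) (+) odd i.
Proof.
move=> gp; elim: i => [|i IH] ip; first by rewrite addbF.
rewrite (e_col (gpath_step x0 gp ip)) IH ?(ltnW ip) //=.
by rewrite addbN.
Qed.

Lemma nth_path_inj x0 p i j : gpath e p -> i < size p -> j < size p ->
  nth x0 p i = nth x0 p j -> i = j.
Proof. by case/andP=> u _ ip jp /eqP; rewrite nth_uniq // => /eqP. Qed.

Lemma gpath_cycle x0 p : gpath e p -> e (last x0 p) (head x0 p) -> cycle e p.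
Proof.
by case: p => //= x p /andP[_ /= o] lx; rewrite rcons_path o.
Qed.

(** By connectedness some edge leaves a cycle that does not cover V; opening the
    cycle at that edge gives a path with one more vertex. *)
Lemma cycle_exit x z C : uniq C -> cycle e C -> x \in C -> x \in V ->
  z \in V -> z \notin C -> exists w q, gpath e (w :: q) /\ perm_eq q C.
Proof.
move=> uC cC xC xV zV zC.
have [|nex] := boolP [exists u, exists w, [&& u \in C, w \notin C & e u w]].
  case/existsP=> u /existsP[w /and3P[uC' wC' euw]].
  have [q gq pq] := cycle_extend e_sym uC cC uC' euw wC'.
  by exists w, q.
case/negP: zC; apply: (closed_all (P := mem C) xV) => // u w euw uC'.
apply: contraT => wC; case/negP: nex; apply/existsP; exists u.
by apply/existsP; exists w; rewrite -[u \in C]/(mem C u) uC' wC.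
Qed.

(** Take a cycle with n vertices in a graph with no path on n + 2 vertices.  A
    neighbour u of the cycle has no further neighbour off it, since opening the
    cycle at u would leave room for two more vertices.  So the cycle and its
    neighbours are closed under adjacency, and connectedness leaves nothing
    else. *)
Lemma off_cycle_nbr C z y : uniq C -> cycle e C ->
  (forall q, gpath e q -> size q <= (size C).+1) -> 0 < size C ->
  {subset C <= V} -> z \in V -> z \notin C -> e z y -> y \in C.
Proof.
move=> uC cC bnd C0 CV zV zC ezy.
have two x u w : x \in C -> u \notin C -> e x u -> e u w -> w \in C.
  move=> xC uC' exu euw; apply: contraT => wC.
  have [q gq pq] := cycle_extend e_sym uC cC xC exu uC'.
  suff /bnd : gpath e (w :: u :: q) by rewrite /= (perm_size pq) ltnn.
  apply: (gpath_cons (x0 := u)) => //; last by rewrite /= e_sym.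
  rewrite inE negb_or (perm_mem pq) wC andbT; apply/eqP => wu.
  by have := e_col euw; rewrite wu; case: (c u).
have [x0 x0C] : exists x, x \in C by case: C C0 {uC cC bnd CV zC two} => // x s _; exists x; rewrite mem_head.
pose P z := (z \in C) || [exists x, (x \in C) && e x z].
have : P z.
  apply: (@closed_all P x0) zV => [||u w euw]; [exact: CV | by rewrite /P x0C |].
  rewrite /P; have [uC' _|uC' /= /existsP[x /andP[xC exu]]] := boolP (u \in C).
    by apply/orP; right; apply/existsP; exists u; rewrite uC'.
  by rewrite (two x u w).
by rewrite /P (negbTE zC) => /existsP[x /andP[xC exz]]; apply: two exz ezy.
Qed.

Lemma nbr_nonempty z x : z \in V -> x \in V -> x != z -> 0 < #|nbr z|.
Proof.
move=> zV xV xz; rewrite lt0n cards_eq0; apply: contra xz => /eqP n0.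
apply: (@closed_all (pred1 z) z) xV => //; first exact: eqxx.
by move=> y w eyw /eqP yz; move/setP/(_ w): n0; rewrite !inE -yz eyw.
Qed.

(** Were the successors of c1 and c2 adjacent, this chord and the cycle without
    its two edges c1 c1+ and c2 c2+ would form a path from c1 to c2 through the
    whole cycle, which u and w would extend at both ends. *)
Lemma cycle_chord C u w c1 c2 : uniq C -> cycle e C ->
  (forall q, gpath e q -> size q <= (size C).+1) ->
  u \notin C -> w \notin C -> u != w -> c1 \in C -> c2 \in C -> c1 != c2 ->
  e u c1 -> e w c2 -> ~~ e (next C c1) (next C c2).
Proof.
move=> uC cC bnd uC' wC uw c1C c2C c12 euc1 ewc2; apply/negP => en.
have [i s rC] := rot_to c1C.
have pe : perm_eq (c1 :: s) C by rewrite -rC perm_rot.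
have c2s : c2 \in s by move: c2C; rewrite -(perm_mem pe) inE eq_sym (negbTE c12).
move: en; rewrite -!(next_rot i uC) rC.
move: cC uC uC' wC bnd; rewrite -(rot_cycle i) rC -(perm_uniq pe) -!(perm_mem pe) -(perm_size pe).
case/splitPr: c2s => s1 s2 cC uC uC' wC bnd.
have n1 : next (c1 :: s1 ++ c2 :: s2) c1 = head c1 (rcons s1 c2).
  by rewrite next_nth mem_head /= eqxx nth0; case: (s1).
have n2 : next (c1 :: s1 ++ c2 :: s2) c2 = head c1 (rcons s2 c1).
  rewrite next_nth inE mem_cat mem_head !orbT /= (negbTE c12) index_cat.
  have -> : c2 \in s1 = false.
    move: uC => /= /andP[_]; rewrite cat_uniq => /and3P[_ + _].
    by move/hasPn/(_ c2 (mem_head _ _))/negbTE.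
  rewrite /= eqxx addn0 nth_cat ltnNge leqnSn /= subSnn /= nth0.
  by case: (s2).
rewrite n1 n2 => en.
suff /bnd : gpath e (w :: (rev (rcons s1 c2) ++ rcons (rcons s2 c1) u)).
  rewrite /= size_cat size_rev !size_rcons /= size_cat /= !addnS !addSn ltnn.
  by [].
move: uC' wC; rewrite !inE !mem_cat !inE !negb_or => /and4P[u1 u2 u3 u4] /and4P[w1 w2 w3 w4].
have [o1 o2] : sorted e (rcons s1 c2) /\ sorted e (rcons s2 c1).
  move: cC => /=; rewrite rcons_cat cat_path /= => /and3P[o1 l1 o2].
  split; last exact: path_sorted o2.
  by apply: (@path_sorted _ _ c1); rewrite rcons_path o1.
apply/andP; split.
  have pu : perm_eq (w :: (rev (rcons s1 c2) ++ rcons (rcons s2 c1) u))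
      (w :: u :: (c1 :: s1 ++ c2 :: s2)).
    rewrite perm_cons; apply/permP => a; rewrite /= !count_cat count_rev /=.
    by rewrite -!cats1 !count_cat /= !addn0; clear; lia.
  rewrite (perm_uniq pu) cons_uniq [uniq (u :: _)]cons_uniq uC.
  by rewrite !inE !mem_cat !inE !negb_or u1 u2 u3 u4 w1 w2 w3 w4 eq_sym uw.
have o1' : sorted e (rev (rcons s1 c2)).
  by rewrite rev_sorted (eq_sorted (e' := e)) // => a b; rewrite e_sym.
rewrite /= cat_path; apply/andP; split.
  by move: o1'; rewrite rev_rcons /= ewc2.
rewrite (_ : last w (rev (rcons s1 c2)) = head c1 (rcons s1 c2)); last first.
  by rewrite -(last_rev c1) rev_rcons.
rewrite rcons_path last_rcons [e c1 u]e_sym euc1 andbT.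
by case: (s2) o2 en => [|a r] /= o2 ->.
Qed.

Definition part b := [set x in V | c x == b].

Definition nonedges := [set xy : T * T |
  [&& xy.1 \in part false, xy.2 \in part true & ~~ e xy.1 xy.2]].

Lemma nbr_part x y : e x y -> y \in part (~~ c x).
Proof. by move=> exy; rewrite inE (e_col exy) eqxx (bip_in G (y := x)) // e_sym. Qed.

Lemma card_non_nbr b x : c x = ~~ b -> #|part b :\: nbr x| + #|nbr x| = #|part b|.
Proof.
move=> cx; rewrite -(cardsID (nbr x) (part b)) addnC (setIidPr _) //.
by apply/subsetP => y; rewrite inE => /nbr_part; rewrite cx negbK.
Qed.

(** Let u have r and w have s neighbours; all of these are on C.  There are k - r
    pairs missing at u, k - s at w, the pair (u, w) being counted twice, and
    r s more between the successors of the two neighbourhoods.  The total is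
    2 k - 2 + (r - 1) (s - 1). *)
Lemma nonedges_cycle k C u w : #|part false| = k -> #|part true| = k ->
  uniq C -> cycle e C -> 0 < size C -> {subset C <= V} ->
  (forall q, gpath e q -> size q <= (size C).+1) ->
  u \in part false -> u \notin C -> w \in part true -> w \notin C ->
  k.*2 <= #|nonedges| + 2.
Proof.
move=> kA kB uC cC C0 CV bnd uA uC' wB wC.
move: (uA) (wB); rewrite !inE => /andP[uV /eqP cu] /andP[wV /eqP cw].
have uw : u != w by apply/eqP => E; rewrite E cw in cu.
have uN y : e u y -> y \in C by apply: off_cycle_nbr C0 CV uV uC'.
have wN y : e w y -> y \in C by apply: off_cycle_nbr C0 CV wV wC.
have neuw : ~~ e u w by apply: contra wC => /uN.
have r0 : 0 < #|nbr u| by apply: (nbr_nonempty uV wV); rewrite eq_sym.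
have s0 : 0 < #|nbr w| by apply: (nbr_nonempty wV uV).
have nA x : x \in next C @: nbr u -> x \in part false /\ x \in C.
  case/imsetP=> y; rewrite inE => euy ->; have yC := uN y euy.
  have := nbr_part (next_cycle cC yC); rewrite (e_col euy) cu.
  by rewrite mem_next.
have nB x : x \in next C @: nbr w -> x \in part true /\ x \in C.
  case/imsetP=> y; rewrite inE => euy ->; have yC := wN y euy.
  have := nbr_part (next_cycle cC yC); rewrite (e_col euy) cw.
  by rewrite mem_next.
pose R1 := setX [set u] (part true :\: nbr u).
pose R2 := setX ((part false :\: nbr w) :\ u) [set w].
pose R3 := setX (next C @: nbr u) (next C @: nbr w).
have c1 : #|R1| + #|nbr u| = k by rewrite cardsX cards1 mul1n card_non_nbr ?cu.
have c2 : #|R2| + 1 + #|nbr w| = k.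
  rewrite cardsX cards1 muln1 -kA -(card_non_nbr (x := w)) ?cw //.
  by rewrite (cardsD1 u (part false :\: nbr w)) in_setD uA inE e_sym neuw /= [1 + _]addnC.
have c3 : #|R3| = #|nbr u| * #|nbr w|.
  by rewrite cardsX !card_imset //; exact: can_inj (prev_next uC).
have h23 : #|R2| + #|R3| <= #|R2 :|: R3|.
  apply: card_disjoint_sub; rewrite ?subsetUl ?subsetUr // => -[x y].
  rewrite !in_setX in_set1 => /andP[_ /eqP->] /andP[_ /nB[_]].
  by apply/negP.
suff h : #|R1| + #|R2 :|: R3| <= #|nonedges|.
  by clear -h h23 c1 c2 c3 r0 s0; nia.
apply: card_disjoint_sub.
- apply/subsetP => -[x y]; rewrite in_setX in_set1 => /andP[/eqP-> ].
  by rewrite !inE /= uV cu /= => /andP[-> ->].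
- rewrite subUset; apply/andP; split; apply/subsetP => -[x y]; rewrite in_setX.
    rewrite in_set1 => /andP[+ /eqP->]; rewrite !inE /= wV cw /= => /and3P[_ ewx ->].
    by rewrite e_sym.
  case/andP=> xS yS; have [xA _] := nA x xS; have [yB _] := nB y yS.
  rewrite inE /= xA yB /=; case/imsetP: xS => x'; rewrite inE => eux ->.
  case/imsetP: yS => y'; rewrite inE => ewy ->.
  apply: (@cycle_chord C u w) => //; [exact: uN | exact: wN |].
  by apply/eqP => E; have := e_col eux; rewrite E (e_col ewy) cu cw.
- move=> [x y]; rewrite in_setU !in_setX !in_set1 => /andP[/eqP-> _].
  rewrite in_setD1 eqxx /= => /andP[/nA[_ uC2] _].
  by case/negP: uC'.
Qed.

(** * Degrees at the ends of a longest path *)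

Section LongestPath.
Variables (x0 : T) (p : seq T).
Hypothesis lp : longest e p.
Hypothesis p2 : 1 < size p.
Local Notation v := (nth x0 p).
Local Notation m := (size p).

Let gp : gpath e p. Proof. by case: lp. Qed.
Let up : uniq p. Proof. by case/andP: gp. Qed.

Lemma path_in i : i < m -> v i \in V.
Proof.
case: i => [|i] ip; first exact: (bip_in G (gpath_step x0 gp p2)).
by apply: (bip_in G (y := v i)); rewrite e_sym gpath_step.
Qed.

Lemma longest_not_cycle C z : z \in V -> z \notin p -> perm_eq C p ->
  cycle e C -> False.
Proof.
move=> zV zp pC cC.
have uC : uniq C by rewrite (perm_uniq pC).
have v0C : v 0 \in C by rewrite (perm_mem pC) mem_nth // ltnW.
have zC : z \notin C by rewrite (perm_mem pC).
have [w [q [gq pq]]] := cycle_exit uC cC v0C (path_in (ltnW p2)) zV zC.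
by have := lp.2 _ gq; rewrite /= (perm_size (perm_trans pq pC)) ltnn.
Qed.

Lemma first_nbr y : e (v 0) y -> exists i, [/\ odd i, i < m & y = v i].
Proof.
move=> e0y; have yp : y \in p by apply: (longest_end e_sym lp (ltnW p2)) e0y => //; exact: ltnW.
exists (index y p); rewrite index_mem nth_index //; split => //.
have iy : index y p < m by rewrite index_mem.
have := path_colour x0 gp iy; rewrite nth_index // (e_col e0y).
by case: (c _); case: (odd _).
Qed.

Lemma last_nbr y : e (v m.-1) y -> exists i, [/\ odd i = odd m, i < m & y = v i].
Proof.
move=> ely; have yp : y \in p by apply: (longest_last e_sym lp (ltnW p2)) ely => //; exact: ltnW.
exists (index y p); rewrite index_mem nth_index //; split => //.
have iy : index y p < m by rewrite index_mem.
have lm : m.-1 < m by lia.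
have := path_colour x0 gp iy; rewrite nth_index // (e_col ely).
rewrite (path_colour x0 gp lm) (_ : odd m.-1 = ~~ odd m); last by lia.
by case: (c _); case: (odd _); case: (odd _).
Qed.

Definition prev_on y := v (index y p).-1.
Definition next_on y := v (index y p).+1.

Lemma prev_on_nth i : i < m -> prev_on (v i) = v i.-1.
Proof. by move=> im; rewrite /prev_on index_uniq. Qed.

Lemma next_on_nth i : i < m -> next_on (v i) = v i.+1.
Proof. by move=> im; rewrite /next_on index_uniq. Qed.

(** The vertices that one rotation can bring to the front of p; the path is
    indexed from 0 throughout. *)
Definition fronts := prev_on @: nbr (v 0).

Definition backs := next_on @: nbr (v m.-1).

Lemma frontsP y : reflect (exists i, [/\ odd i, i < m, e (v 0) (v i) & y = v i.-1])
  (y \in fronts).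
Proof.
apply: (iffP imsetP) => [[x]|[i [oi im e0i ->]]]; last first.
  by exists (v i); rewrite ?inE ?prev_on_nth.
rewrite inE => e0x ->; have [i [oi im xE]] := first_nbr e0x.
by exists i; rewrite xE prev_on_nth // -xE.
Qed.

Lemma card_fronts : #|fronts| = #|nbr (v 0)|.
Proof.
rewrite card_in_imset // => x y; rewrite !inE => /first_nbr[i [oi im ->]].
case/first_nbr=> j [oj jm ->]; rewrite !prev_on_nth // => /nth_path_inj.
by move=> /(_ gp) ij; congr nth; have := odd_gt0 oi; have := odd_gt0 oj; lia.
Qed.

Lemma backsP y : reflect
  (exists i, [/\ odd i = odd m, i.+1 < m, e (v m.-1) (v i) & y = v i.+1])
  (y \in backs).
Proof.
apply: (iffP imsetP) => [[x]|[i [oi im e0i ->]]]; last first.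
  by exists (v i); rewrite ?inE ?next_on_nth // ltnW.
rewrite inE => e0x ->; have [i [oi im xE]] := last_nbr e0x.
exists i; rewrite xE next_on_nth // -xE; split => //.
by case: (ltngtP i.+1 m) im oi => // <- _ /=; case: odd.
Qed.

Lemma card_backs : #|backs| = #|nbr (v m.-1)|.
Proof.
rewrite card_in_imset // => x y; rewrite !inE => /last_nbr[i [oi im ->]].
case/last_nbr=> j [oj jm ->]; rewrite !next_on_nth // => E.
have im' : i.+1 < m by case: (ltngtP i.+1 m) im oi => // <- _ /=; case: odd.
have jm' : j.+1 < m by case: (ltngtP j.+1 m) jm oj => // <- _ /=; case: odd.
by have [->] := nth_path_inj gp im' jm' E.
Qed.

Lemma fronts_nbr y z : y \in fronts -> e y z -> z \in p.
Proof.
case/frontsP=> i [oi im e0i ->]; apply: (longest_rotation e_sym lp _ e0i).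
by rewrite odd_gt0.
Qed.

Lemma backs_nbr y z : y \in backs -> e y z -> z \in p.
Proof.
case/backsP=> i [oi im eli ->] eiz; rewrite -mem_rev.
apply: (longest_rotation e_sym (x0 := x0) (i := m - i.+1) (longest_rev e_sym lp)).
- by rewrite size_rev; lia.
- by rewrite !nth_rev; [rewrite subn1 (_ : m - (m - i.+1).+1 = i) //; lia| lia|lia].
- by rewrite nth_rev; [rewrite (_ : m - (m - i.+1).-1.+1 = i.+1) //; lia|lia].
Qed.

Lemma first_in_fronts : v 0 \in fronts.
Proof. by apply/frontsP; exists 1; rewrite gpath_step. Qed.

Lemma last_in_backs : v m.-1 \in backs.
Proof.
apply/backsP; exists m.-2; split; try lia.
  by rewrite e_sym (_ : m.-1 = m.-2.+1) ?gpath_step //; lia.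
by congr nth; lia.
Qed.

Definition even_positions t := [set v i.*2 | i : 'I_t].

Lemma card_even_positions t : #|even_positions t| <= t.
Proof. by rewrite -[leqRHS]card_ord leq_imset_card. Qed.

Lemma mem_even_positions t i : i < t.*2 -> ~~ odd i -> v i \in even_positions t.
Proof.
move=> it oi; have it2 : i./2 < t by lia.
by apply/imsetP; exists (Ordinal it2) => //=; congr nth; lia.
Qed.

(** An even path has ends of opposite colours, so both the fronts and the
    neighbours of the last vertex sit at the t even positions.  They are
    disjoint: if v_{i-1} is in both, rotating it to the front closes a cycle on
    the vertices of p, and leaving this cycle gives a longer path. *)
Lemma even_ends_degree t z : m = t.*2 -> z \in V -> z \notin p ->
  #|nbr (v 0)| + #|nbr (v m.-1)| <= t.
Proof.
move=> mt zV zp; rewrite -card_fronts.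
apply: leq_trans (card_even_positions t); apply: card_disjoint_sub.
- apply/subsetP => y /frontsP[i [oi im _ ->]].
  by apply: mem_even_positions; lia.
- apply/subsetP => y; rewrite inE => /last_nbr[i [oi im ->]].
  by apply: mem_even_positions; lia.
move=> y /frontsP[i [oi im e0i ->]]; rewrite inE => eli.
have i0 := odd_gt0 oi.
apply: (@longest_not_cycle (rev (take i p) ++ drop i p) z) => //.
  by rewrite -[X in perm_eq _ X](cat_take_drop i p) perm_cat2r perm_rev.
apply: (gpath_cycle (x0 := x0)).
  by apply: gpath_flip => // [|_ _]; [exact: ltnW | exact: e0i].
rewrite last_cat -nth0 nth_cat size_rev size_takel ?i0; last exact: ltnW.
rewrite nth0 head_rev last_take ?i0 ?(ltnW im) //.
rewrite -nth_last nth_drop size_drop (set_nth_default x0); last by lia.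
by rewrite (_ : i + (m - i).-1 = m.-1) //; lia.
Qed.

(** Both ends of p have the same colour, and q is a branch hanging from v_j whose
    last vertex x has the other colour.  Three sets have to fit disjointly into
    the t even positions before the last: the fronts, the neighbours of x on p,
    and the copy of the neighbours of x on q obtained by laying q along
    v_{j+1}, v_{j+2}, ...  A coincidence would give a longer path, either a
    rotation or a detour of p through q. *)
Lemma odd_ends_degree t q j : m = t.*2.+1 -> gpath e q -> ~~ has (mem p) q ->
  0 < size q -> j < m -> e (v j) (head x0 q) -> c (last x0 q) != c (v 0) ->
  (forall y, e (last x0 q) y -> y \in p ++ q) ->
  #|nbr (v 0)| + #|nbr (last x0 q)| <= t.
Proof.
set x := last x0 q => mt gq dis l0 jm ejq cx nx.
have qp y : y \in q -> y \notin p by move=> yq; apply: (hasPn dis).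
have xnp : x \notin p by apply/qp/last_in.
(* p followed up to v_j and then along q *)
have jl : j.+1 + size q <= m.
  have /lp.2 : gpath e (take j.+1 p ++ q).
    apply: (gpath_cat (x0 := x0)) => //; first exact: gpath_take.
      by apply: contra dis; apply: sub_has => y /mem_take.
    by move=> _ _; rewrite last_take.
  by rewrite size_cat size_takel.
pose shift y := v (j.+1 + index y q).
set P := nbr x :&: [set y in p]; set Q := nbr x :&: [set y in q].
have QE y : y \in Q -> index y q < (size q).-1 /\ ~~ odd (j.+1 + index y q).
  rewrite !inE => /andP[exy yq]; have iy : index y q < size q by rewrite index_mem.
  have xE : x = nth x0 q (size q).-1 by rewrite nth_last.
  have yE : y = nth x0 q (index y q) by rewrite nth_index.
  split.
    have [//|le] := ltnP (index y q) (size q).-1.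
    have ix : index y q = (size q).-1 by clear -iy le; lia.
    by have := e_col exy; rewrite xE yE ix; case: (c _).
  have := e_col exy; rewrite [in LHS]yE path_colour // nth0 (e_col ejq).
  rewrite path_colour //; move: cx; case: (c x); case: (c (v 0)) => //= _;
  by rewrite oddD /=; case: (odd j); case: (odd _).
have sQ : #|shift @: Q| = #|Q|.
  rewrite card_in_imset // => y z yQ zQ /nth_path_inj -/(_ gp) E.
  have [iy _] := QE _ yQ; have [iz _] := QE _ zQ.
  have ii : index y q = index z q by clear -E jl iy iz; lia.
  move: yQ zQ; rewrite !inE => /andP[_ yq] /andP[_ zq].
  by rewrite -[y](nth_index x0 yq) ii nth_index.
have nE : #|nbr x| <= #|P :|: shift @: Q|.
  apply: leq_trans (card_disjoint_sub (subsetUl P _) (subsetUr _ _) _).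
    rewrite sQ -cardsUI; apply: leq_trans (leq_addr _ _).
    apply: subset_leq_card; apply/subsetP => y; rewrite !inE => exy.
    by rewrite exy /= -mem_cat nx.
  move=> y; rewrite !inE => /andP[exy yp] /imsetP[z zQ yE].
  have [iz _] := QE _ zQ; have := zQ; rewrite !inE => /andP[_ zq].
    (* a neighbour v_(j+1+i) of x: p leaves at v_j and returns from x *)
  have /lp.2 : gpath e (take j.+1 p ++ (q ++ drop (j.+1 + index z q) p)).
    have iz' : index z q < size q by rewrite index_mem.
    apply: (gpath_cat (x0 := x0)); first exact: gpath_take.
    - apply: (gpath_cat (x0 := x0)) => //; first exact: gpath_drop.
        rewrite has_sym; apply: contra dis => /hasP[w wq /mem_drop wp].
        by apply/hasP; exists w.
      by move=> _ _; rewrite head_drop -/(shift z) -yE.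
    - rewrite has_cat negb_or; apply/andP; split.
        by apply: contra dis; apply: sub_has => w /mem_take.
      by apply: has_take_drop => //; rewrite leq_addr.
    - by move=> _ _; rewrite last_take // head_cat.
  by rewrite size_cat size_takel // size_cat size_drop; clear -iz jl l0; lia.
rewrite -card_fronts; apply: leq_trans (card_even_positions t).
apply: leq_trans (_ : #|fronts| + #|P :|: shift @: Q| <= _).
  by rewrite leq_add2l.
apply: card_disjoint_sub.
- apply/subsetP => y /frontsP[i [oi im _ ->]].
  by apply: mem_even_positions; clear -oi im mt; lia.
- rewrite subUset; apply/andP; split; apply/subsetP => y; last first.
    case/imsetP=> z /QE[iz oz] ->; apply: mem_even_positions => //.
    by clear -iz jl mt l0; lia.
  rewrite !inE => /andP[exy yp].
  have iy : index y p < m by rewrite index_mem.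
  have oy := path_colour x0 gp iy; rewrite nth_index // (e_col exy) in oy.
  rewrite -[y](nth_index x0 yp); apply: mem_even_positions.
    rewrite ltn_neqAle; apply/andP; split; last by rewrite -ltnS -mt.
    apply: contra xnp => /eqP iy2; apply: (longest_last e_sym lp (ltnW p2) (x0 := x0)).
    by rewrite mt /= -iy2 nth_index // e_sym.
  by move: oy cx; case: (c x); case: (c (v 0)); case: odd.
- move=> y /frontsP[i [oi im e0i ->]]; rewrite !inE => /orP[/andP[exy _]|].
    case/negP: xnp.
    apply: (longest_rotation e_sym lp _ e0i); first by rewrite odd_gt0.
    by rewrite e_sym.
  case/imsetP=> z zQ /nth_path_inj -/(_ gp) E.
  have [iz oz] := QE _ zQ; have := odd_gt0 oi => i0.
  (* a front v_(j+1+i): x, ..., v_j, ..., v_0, then the chord to v_(j+2+i) *)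
  have /lp.2 : gpath e (rev q ++ (rev (take j.+1 p) ++ drop i p)).
    apply: (gpath_cat (x0 := x0)).
    - by rewrite gpath_rev.
    - by apply: (gpath_flip e_sym (x0 := x0)) => //; clear -E oi iz jl l0; lia.
    - rewrite (eq_has (mem_rev q)) has_cat negb_or; apply/andP; split.
        rewrite has_sym; apply: contra dis => /hasP[w wq].
        by rewrite /= mem_rev => /mem_take wp; apply/hasP; exists w.
      rewrite has_sym; apply: contra dis => /hasP[w wq /mem_drop wp].
      by apply/hasP; exists w.
    - move=> _ _; rewrite last_rev head_cat ?size_rev ?size_takel //.
      by rewrite head_rev last_take // e_sym.
  by rewrite size_cat size_rev size_cat size_rev size_takel // size_drop;
    clear -E oi im iz jl l0; lia.
Qed.

(** If v_0 is adjacent to all t odd positions, every even position is the end of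
    a longest path and has no neighbour off p.  A vertex off p next to an odd
    position has no neighbour off p either, since a path could come in through
    the two of them and still run through all but one vertex of p.  So
    every vertex off p is next to an odd position, and has the colour of v_0. *)
Lemma first_degree_lt t u : m = t.*2.+1 -> u \in V -> u \notin p ->
  c u != c (v 0) -> #|nbr (v 0)| < t.
Proof.
move=> mt uV up' cu; rewrite ltnNge; apply/negP => td.
have fE : fronts = even_positions t.
  apply/eqP; rewrite eqEcard card_fronts; apply/andP; split.
    apply/subsetP => y /frontsP[i [oi im _ ->]].
    by apply: mem_even_positions; clear -oi im mt; lia.
  exact: leq_trans (card_even_positions t) td.
have e0 i : odd i -> i < m -> e (v 0) (v i).
  move=> oi im; have : v i.-1 \in fronts.
    by rewrite fE mem_even_positions //; clear -oi im mt; lia.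
  case/frontsP => j [oj jm ej /nth_path_inj -/(_ gp)] E.
  have := odd_gt0 oi; have := odd_gt0 oj => j0 i0.
  by rewrite (_ : i = j) //; clear -E i0 j0 im jm; lia.
have exit y z : y \in p -> e y z -> z \notin p -> odd (index y p) && (c z == c (v 0)).
  move=> yp eyz zp; have iy : index y p < m by rewrite index_mem.
  have oi : odd (index y p).
    apply: contraT => oi; case/negP: zp.
    have [il|il] := ltnP (index y p) t.*2.
      apply: (@fronts_nbr y) => //.
      by rewrite fE -[y](nth_index x0 yp) mem_even_positions.
    apply: (longest_last e_sym lp (ltnW p2) (x0 := x0)).
    by rewrite mt /= (_ : t.*2 = index y p) ?nth_index //; clear -mt iy il; lia.
  rewrite oi /= (e_col eyz); have := path_colour x0 gp iy.
  by rewrite nth_index // oi => ->; case: (c _).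
pose P y := (y \in p) || [exists x, [&& x \in p, e x y & y \notin p]].
have /orP[|/existsP[x /and3P[xp exu _]]] : P u.
- apply: (@closed_all P (v 0)) uV => [||y z eyz].
  + exact: path_in (ltnW p2).
  + by rewrite /P mem_nth // ltnW.
  rewrite /P; case zp: (z \in p) => //=.
  have [yp _|yp /= /existsP[x /and3P[xp exy _]]] := boolP (y \in p).
    by apply/existsP; exists y; rewrite yp eyz.
  have /andP[oi _] := exit x y xp exy yp.
  set i := index x p in oi; have im : i < m by rewrite index_mem.
  have /lp.2 : gpath e (z :: y :: (rev (take i.+1 p) ++ drop i.+2 p)).
    have np w : w \notin p -> w \notin rev (take i.+1 p) ++ drop i.+2 p.
      apply: contra; rewrite mem_cat mem_rev => /orP[/mem_take|/mem_drop] //.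
    apply: (gpath_cons (x0 := x0)) => /=; last by rewrite e_sym.
    - apply: (gpath_cons (x0 := x0)).
      + apply: (gpath_flip e_sym (x0 := x0)) => // _ i2; apply: e0 => //.
        by rewrite /= negbK.
      + exact: np.
      + rewrite head_cat ?size_rev ?size_takel // head_rev last_take //=.
        by rewrite nth_index // e_sym.
    - rewrite inE negb_or np ?zp // andbT; apply/eqP => yz.
      by move: (e_col eyz); rewrite yz; case: (c y).
  by rewrite /= size_cat size_rev size_takel // size_drop; clear -im; lia.
- by apply/negP.
- by have /andP[_ /eqP E] := exit x u xp exu up'; rewrite E eqxx in cu.
Qed.

Definition del (D : {set T}) := [rel x y | [&& x \notin D, y \notin D & e x y]].

Lemma del_sym D : symmetric (del D).
Proof. by move=> x y /=; rewrite e_sym andbCA. Qed.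

(** Any path through a deleted vertex d can be rerouted as soon as all surviving
    neighbours of d are still connected to a common vertex r. *)
Lemma bip_del (D : {set T}) r : r \in V -> r \notin D ->
  (forall d y, d \in D -> y \notin D -> e d y -> connect (del D) r y) ->
  bipgraph (V :\: D) (del D) c.
Proof.
move=> rV rD nD; split.
- exact: del_sym.
- by move=> x y /and3P[_ _ /e_col].
- by move=> x y /and3P[xD _ exy]; rewrite inE xD (bip_in G exy).
have rc y : y \in V -> y \notin D -> connect (del D) r y.
  move=> yV yD; pose P z := (z \in D) || connect (del D) r z.
  suff : P y by rewrite /P (negbTE yD).
  apply: (@closed_all P r) yV => // [|z w ezw]; first by rewrite /P connect0 orbT.
  rewrite /P; have [//|wD] := boolP (w \in D).
  have [zD _|zD /= rz] := boolP (z \in D); first by rewrite (nD z).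
  by rewrite (connect_trans rz) // connect1 //= zD wD.
move=> x y; rewrite !inE => /andP[xD xV] /andP[yD yV].
apply: (connect_trans (y := r)); last exact: rc.
by rewrite (sym_connect_sym (del_sym D)) rc.
Qed.

Lemma core_conn (D : {set T}) i : 2 < m ->
  (forall k, k < m -> v k \in D -> k = 0 \/ k = m.-1) ->
  i < m -> v i \notin D -> connect (del D) (v 1) (v i).
Proof.
move=> m2 ends.
have mid k : 0 < k < m.-1 -> v k \notin D.
  move=> /andP[k0 km]; apply/negP => /ends.
  by clear -k0 km; lia.
case: i => [|i] im viD.
  rewrite connect1 //= viD e_sym gpath_step // mid //=.
  by clear -m2; lia.
elim: i im viD => [|i IH] im viD; first exact: connect0.
have viD' : v i.+1 \notin D by apply: mid; clear -im; lia.
by rewrite (connect_trans (IH (ltnW im) viD')) // connect1 //= viD viD' gpath_step.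
Qed.

Lemma bip_del_ends (D : {set T}) : 2 < m ->
  (forall k, k < m -> v k \in D -> k = 0 \/ k = m.-1) ->
  (forall d y, d \in D -> y \notin D -> e d y -> y \in p) ->
  bipgraph (V :\: D) (del D) c.
Proof.
move=> m2 ends nD; apply: (@bip_del D (v 1)); first exact: path_in.
  by apply/negP => /ends -/(_ (ltnW m2)); clear -m2; lia.
move=> d y dD yD edy; have yp := nD d y dD yD edy.
rewrite -[y](nth_index x0 yp); apply: core_conn => //; last by rewrite nth_index.
by rewrite index_mem.
Qed.

(** The neighbours of x lie on p and on the branch q, and what remains of these
    two paths stays joined by the edge from v_j to q. *)
Lemma bip_del_branch q j (D : {set T}) : 2 < m ->
  gpath e q -> ~~ has (mem p) q ->
  0 < size q -> j < m -> e (v j) (head x0 q) ->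
  (forall y, e (last x0 q) y -> y \in p ++ q) ->
  last x0 q \in D -> D \subset [set last x0 q; v 0] ->
  bipgraph (V :\: D) (del D) c.
Proof.
set x := last x0 q => m2 gq dis l0 jm ejq nx xD DE.
have qp y : y \in q -> y \notin p by move=> yq; apply: (hasPn dis).
have pq y : y \in p -> y \notin q by apply: contraL; exact: qp.
have xq : x \in q by apply: last_in.
have uq : uniq q by case/andP: gq.
have ends k : k < m -> v k \in D -> k = 0 \/ k = m.-1.
  move=> km /(subsetP DE); rewrite !inE => /orP[/eqP E|].
    by case/negP: (qp _ xq); rewrite -E mem_nth.
  by rewrite nth_uniq ?(ltnW p2) // => /eqP; left.
have core y : y \in p -> y \notin D -> connect (del D) (v 1) y.
  move=> yp yD; rewrite -[y](nth_index x0 yp); apply: core_conn => //.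
    by rewrite index_mem.
  by rewrite nth_index.
have qD i : i < (size q).-1 -> nth x0 q i \notin D.
  move=> iq; have iq' : i < size q by clear -iq; lia.
  have lq : (size q).-1 < size q by rewrite prednK.
  apply/negP => /(subsetP DE); rewrite !inE => /orP[|/eqP E].
    rewrite /x -nth_last nth_uniq //.
    by move=> /eqP E; rewrite E ltnn in iq.
  by case/negP: (qp _ (mem_nth x0 iq')); rewrite E mem_nth // ltnW.
have vjD : v j \notin D.
  apply/negP => /(subsetP DE); rewrite !inE => /orP[/eqP E|].
    by case/negP: (qp _ xq); rewrite -E mem_nth.
  rewrite nth_uniq // ?(ltnW p2) // => /eqP j0.
  rewrite j0 in ejq.
  have := longest_end e_sym lp (ltnW p2) ejq; apply/negP/qp.
  by rewrite -nth0 mem_nth.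
have br i : i < (size q).-1 -> connect (del D) (v 1) (nth x0 q i).
  elim: i => [|i IH] iq.
    apply: connect_trans (core _ (mem_nth _ jm) vjD) _.
    by rewrite connect1 //= vjD qD //= nth0.
  apply: connect_trans (IH (ltnW iq)) _.
  by rewrite connect1 //= (qD _ iq) (qD _ (ltnW iq)) gpath_step //; clear -iq; lia.
apply: (@bip_del D (v 1)); first exact: path_in.
  by apply/negP => /ends -/(_ (ltnW m2)); clear -m2; lia.
move=> d y /(subsetP DE); rewrite !inE => /orP[]/eqP-> yD; last first.
  by move/(longest_end e_sym lp (ltnW p2)) => yp; apply: core.
move/nx; rewrite mem_cat => /orP[yp|yq]; first exact: core.
rewrite -[y](nth_index x0 yq); apply: br.
have : index y q < size q by rewrite index_mem.
suff : index y q != (size q).-1 by clear; lia.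
by apply: contra yD => /eqP E; rewrite -[y](nth_index x0 yq) E nth_last.
Qed.

Lemma longest_gt2 z : z \in V -> z \notin p -> 2 < m.
Proof.
move=> zV zp; rewrite ltn_neqAle p2 andbT; apply: contra zp => /eqP m2.
apply: (@closed_all (mem p) (v 0)) zV => //.
- exact: path_in (ltnW p2).
- by rewrite inE mem_nth // ltnW.
move=> y w eyw; rewrite !inE => yp.
have : index y p < 2 by rewrite m2 index_mem.
have := nth_index x0 yp; case: (index y p) => [|[|i]] // E _.
  by apply: (longest_end e_sym lp (ltnW p2) (x0 := x0)); rewrite E.
by apply: (longest_last e_sym lp (ltnW p2) (x0 := x0)); rewrite -m2 /= E.
Qed.

(** * Counting missing edges in the balanced case *)

Lemma fronts_part : fronts \subset part (c (v 0)).
Proof.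
apply/subsetP => y /frontsP[i [oi im e0i ->]]; have im' := leq_ltn_trans (leq_pred _) im.
rewrite inE path_in // (path_colour x0 gp im').
by rewrite (_ : odd i.-1 = false) ?addbF ?eqxx //; clear -oi; lia.
Qed.

Lemma backs_part : backs \subset part (c (v m.-1)).
Proof.
apply/subsetP => y /backsP[i [oi im e0i ->]].
have lm : m.-1 < m by clear -im; lia.
rewrite inE path_in // (path_colour x0 gp im) (path_colour x0 gp lm).
by rewrite (_ : odd i.+1 = odd m.-1) ?eqxx //; clear -oi im; lia.
Qed.

Lemma fronts_on y : y \in fronts -> y \in p.
Proof.
case/frontsP=> i [_ im _ ->]; apply: mem_nth.
exact: leq_ltn_trans (leq_pred _) im.
Qed.

Lemma backs_on y : y \in backs -> y \in p.
Proof. by case/backsP=> i [oi im _ ->]; rewrite mem_nth. Qed.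

(** Let d and d' be the degrees of the first and the last vertex.  There are k - d
    pairs missing at v_0 and k - d' at the last vertex, with one pair in common;
    w misses the d - 1 other fronts and u misses the d' - 1 other backs, since
    fronts and backs have no neighbour off p.  That gives 2 k - 3.  The last
    missing pair is (u, w) or, if w u is an edge, (u, v_1), for else the path
    w, u, v_1, v_2, ... would be longer than p. *)
Lemma nonedges_even k u w : ~~ odd m -> c (v 0) = false ->
  #|part false| = k -> #|part true| = k ->
  u \in part false -> u \notin p -> w \in part true -> w \notin p ->
  k.*2 <= #|nonedges| + 2.
Proof.
move=> em c0 kA kB uA up' wB wp.
move: (uA) (wB); rewrite !inE => /andP[uV /eqP cu] /andP[wV /eqP cw].
have m2 := longest_gt2 uV up'.
have lm : m.-1 < m by rewrite prednK // ltnW.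
have cl : c (v m.-1) = true.
  by rewrite (path_colour x0 gp lm) c0 addFb; clear -em p2; lia.
have n0l : ~~ e (v 0) (v m.-1).
  apply/negP => e0l; apply: (longest_not_cycle uV up' (perm_refl p)).
  by apply: (gpath_cycle (x0 := x0)) => //; rewrite -nth_last -nth0 e_sym.
have AV x : x \in part false -> x \in V by rewrite inE => /andP[].
have fA := subsetP fronts_part; have bB := subsetP backs_part.
rewrite c0 in fA; rewrite cl in bB.
(* the pair (u, w') is missing in both cases *)
pose w' := if e u w then v 1 else w.
have w'B : w' \in part true.
  rewrite /w'; case: ifP => // _.
  by have := nbr_part (gpath_step x0 gp p2); rewrite c0.
have w'b : w' \notin backs.
  rewrite /w'; case: ifP => _; last by apply: contra wp; apply: backs_on.
  apply: contra n0l => /backsP[i [oi im eli]].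
  by move/(nth_path_inj gp p2 im) => [i0]; rewrite e_sym i0.
have w'l : w' != v m.-1.
  rewrite /w'; case: ifP => _; last by apply: contraNneq wp => ->; rewrite mem_nth.
  by rewrite nth_uniq //; clear -m2; lia.
have euw' : ~~ e u w'.
  rewrite /w'; case: ifP => [euw|->] //; apply/negP => eu1.
  have /lp.2 : gpath e (w :: u :: drop 1 p).
    have nd z : z \notin p -> z \notin drop 1 p by apply: contra; exact: mem_drop.
    apply: (gpath_cons (x0 := x0)) => /=; last by rewrite e_sym.
    - apply: (gpath_cons (x0 := x0)); [exact: gpath_drop|exact: nd|].
      by rewrite head_drop.
    - rewrite inE negb_or nd // andbT; apply/eqP => E.
      by rewrite -E cw in cu.
  by rewrite /= size_drop; clear -p2; lia.
pose R1 := setX [set v 0] (part true :\: nbr (v 0)).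
pose R2 := setX ((part false :\: nbr (v m.-1)) :\ v 0) [set v m.-1].
pose R3 := setX (fronts :\ v 0) [set w].
pose R4 := setX [set u] (w' |: (backs :\ v m.-1)).
have c1 : #|R1| + #|nbr (v 0)| = k by rewrite cardsX cards1 mul1n card_non_nbr ?c0.
have v0A : v 0 \in part false by rewrite inE c0 path_in // ltnW.
have vlB : v m.-1 \in part true by rewrite inE cl path_in.
have c2 : #|R2| + 1 + #|nbr (v m.-1)| = k.
  rewrite cardsX cards1 muln1 -kA -(card_non_nbr (x := v m.-1)) ?cl //.
  by rewrite (cardsD1 (v 0) (part false :\: nbr (v m.-1))) in_setD v0A inE e_sym n0l /= [1 + _]addnC.
have c3 : #|R3| + 1 = #|nbr (v 0)|.
  by rewrite cardsX cards1 muln1 -card_fronts (cardsD1 (v 0) fronts) first_in_fronts addnC.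
have c4 : #|R4| = #|nbr (v m.-1)|.
  rewrite cardsX cards1 mul1n cardsU1 -card_backs in_setD1 negb_and w'b orbT.
  by rewrite (cardsD1 (v m.-1) backs) last_in_backs.
have h34 : #|R3| + #|R4| <= #|R3 :|: R4|.
  apply: card_disjoint_sub; rewrite ?subsetUl ?subsetUr // => -[x y].
  rewrite !in_setX !in_set1 => /andP[xf _] /andP[/eqP xu _].
  by case/negP: up'; rewrite -xu fronts_on //; case/setD1P: xf.
have h234 : #|R2| + #|R3 :|: R4| <= #|R2 :|: (R3 :|: R4)|.
  apply: card_disjoint_sub; rewrite ?subsetUl ?subsetUr // => -[x y].
  rewrite in_setX in_set1 => /andP[_ /eqP->].
  rewrite in_setU !in_setX !in_set1 => /orP[/andP[_ /eqP E]|].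
    by case/negP: wp; rewrite -E mem_nth.
  rewrite in_setU1 in_setD1 eqxx /= orbF => /andP[_ /eqP E].
  by rewrite -E eqxx in w'l.
suff h : #|R1| + #|R2 :|: (R3 :|: R4)| <= #|nonedges|.
  by clear -h h34 h234 c1 c2 c3 c4; lia.
apply: card_disjoint_sub.
- apply/subsetP => -[x y]; rewrite in_setX in_set1 => /andP[/eqP->].
  rewrite in_setD => /andP[ny yB]; rewrite inE in ny.
  by rewrite inE /= v0A yB.
- rewrite !subUset; apply/and3P; split; apply/subsetP => -[x y]; rewrite in_setX.
  + rewrite in_setD1 in_setD in_set1 => /andP[/and3P[_ nx xA] /eqP->].
    by rewrite inE /= xA vlB /= e_sym; rewrite inE in nx.
  + rewrite in_setD1 in_set1 => /andP[/andP[_ xf] /eqP->].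
    rewrite inE /= fA // wB /=; apply: contra wp; exact: fronts_nbr.
  + rewrite in_set1 in_setU1 in_setD1 => /andP[/eqP-> /orP[/eqP->|/andP[_ yb]]].
      by rewrite inE /= uA w'B.
    rewrite inE /= uA bB //=; apply: contra up' => euy.
    by apply: (backs_nbr yb); rewrite e_sym.
- move=> [x y]; rewrite !in_setU !in_setX !in_set1 => /andP[/eqP-> _].
  rewrite !in_setD1 eqxx /= => /andP[/eqP E _].
  by case/negP: up'; rewrite -E mem_nth // ltnW.
Qed.

(** Both ends have the colour false.  If fronts and backs are disjoint, w misses
    all of them: with k - d pairs missing at v_0 and k - d' at the last vertex
    this makes 2 k - 2.  If some v_{i-1} is both a front and a back, then
    dropping it closes the rest of p to a cycle, and the count on cycles
    applies to v_{i-1} and w. *)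
Lemma nonedges_odd k w : odd m -> c (v 0) = false ->
  #|part false| = k -> #|part true| = k ->
  w \in part true -> w \notin p ->
  k.*2 <= #|nonedges| + 2.
Proof.
move=> em c0 kA kB wB wp.
have wV : w \in V by move: wB; rewrite inE => /andP[].
have m2 := longest_gt2 wV wp.
have lm : m.-1 < m by rewrite prednK // ltnW.
have m0 : 0 < m by rewrite ltnW.
have cl : c (v m.-1) = false.
  by rewrite (path_colour x0 gp lm) c0 addFb; clear -em p2; lia.
have [dis|ndis] := boolP (fronts :&: backs == set0); last first.
  case/set0Pn: ndis => y /setIP[/frontsP[i [oi im e0i ->]] /backsP[j [oj jm elj yE]]].
  have im' := leq_ltn_trans (leq_pred _) im.
  have E := nth_path_inj gp im' jm yE.
  pose C := rev (take i.-1 p) ++ drop i p.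
  have i0 : 0 < i.-1 by rewrite E.
  have i1 := ltnW im'.
  have gC : gpath e C by apply: (gpath_flip e_sym (x0 := x0)) => //; rewrite ?leq_pred // ltnW.
  have sC : (size C).+1 = m.
    by rewrite size_cat size_rev size_takel // size_drop; clear -i0 im; lia.
  have Cp z : z \in C -> z \in p.
    by rewrite mem_cat mem_rev => /orP[/mem_take|/mem_drop].
  have uC : v i.-1 \notin C.
    move: up; rewrite -[X in uniq X](cat_take_drop i p) -[X in take X p](prednK (odd_gt0 oi)).
    rewrite (take_nth x0 im') cat_uniq rcons_uniq => /and3P[/andP[yt _] yd _].
    rewrite mem_cat mem_rev negb_or yt /=; apply: contra yd => yd.
    by apply/hasP; exists (v i.-1); rewrite //= mem_rcons mem_head.
  have uA : v i.-1 \in part false.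
    by rewrite -c0; apply: (subsetP fronts_part); apply/frontsP; exists i.
  apply: (@nonedges_cycle k C (v i.-1) w) => //.
  - by case/andP: gC.
  - apply: (gpath_cycle (x0 := x0)) => //.
    rewrite head_cat ?size_rev ?size_takel // head_rev last_take ?i0 //.
    rewrite last_cat -nth_last nth_drop size_drop (set_nth_default x0); last by clear -im; lia.
    rewrite (_ : i + (m - i).-1 = m.-1); last by clear -im; lia.
    by rewrite E.
  - by clear -sC m2; lia.
  - move=> z /Cp zp; rewrite -[z](nth_index x0 zp) path_in // index_mem //.
  - by rewrite sC; exact: lp.2.
  - by apply: contra wp => /Cp.
have v0l : v m.-1 != v 0 by rewrite nth_uniq //; clear -m2; lia.
have fA := subsetP fronts_part; have bA := subsetP backs_part.
rewrite c0 in fA; rewrite cl in bA.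
pose R1 := setX [set v 0] (part true :\: nbr (v 0)).
pose R2 := setX [set v m.-1] (part true :\: nbr (v m.-1)).
pose R3 := setX ((fronts :|: backs) :\ v 0 :\ v m.-1) [set w].
have c1 : #|R1| + #|nbr (v 0)| = k by rewrite cardsX cards1 mul1n card_non_nbr ?c0.
have c2 : #|R2| + #|nbr (v m.-1)| = k by rewrite cardsX cards1 mul1n card_non_nbr ?cl.
have v0A : v 0 \in part false by rewrite inE c0 path_in // ltnW.
have vlA : v m.-1 \in part false by rewrite inE cl path_in.
have c3 : #|nbr (v 0)| + #|nbr (v m.-1)| <= 2 + #|R3|.
  rewrite -card_fronts -card_backs cardsX cards1 muln1.
  have := cardsD1 (v 0) (fronts :|: backs).
  rewrite (cardsD1 (v m.-1) (_ :\ v 0)) in_setD1 v0l !in_setU first_in_fronts last_in_backs orbT /=.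
  by rewrite addnA => <-; rewrite cardsU (eqP dis) cards0 subn0.
have h23 : #|R2| + #|R3| <= #|R2 :|: R3|.
  apply: card_disjoint_sub; rewrite ?subsetUl ?subsetUr // => -[x y].
  rewrite !in_setX in_set1 => /andP[/eqP-> _] /andP[+ _].
  by rewrite in_setD1 eqxx.
suff h : #|R1| + #|R2 :|: R3| <= #|nonedges|.
  by clear -h h23 c1 c2 c3; lia.
apply: card_disjoint_sub.
- apply/subsetP => -[x y]; rewrite in_setX in_set1 => /andP[/eqP->].
  rewrite in_setD => /andP[ny yB]; rewrite inE in ny.
  by rewrite inE /= v0A yB.
- rewrite !subUset; apply/andP; split; apply/subsetP => -[x y]; rewrite in_setX.
  + rewrite in_set1 => /andP[/eqP->].
    rewrite in_setD => /andP[ny yB]; rewrite inE in ny.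
  by rewrite inE /= vlA yB.
  + rewrite !in_setD1 in_setU in_set1 => /andP[/and3P[_ _ xf] /eqP->].
    rewrite inE /= wB /=; case/orP: xf => xf.
      rewrite fA //=; apply: contra wp; exact: fronts_nbr.
    rewrite bA //=; apply: contra wp; exact: backs_nbr.
- move=> [x y]; rewrite !in_setU !in_setX !in_set1 => /andP[/eqP-> _].
  by rewrite !in_setD1 eqxx /= andbF /= orbF eq_sym (negbTE v0l).
Qed.

Definition on_path b := [set y in p | c y == b].

Lemma on_path_opposite t : m <= t.*2.+1 -> #|on_path (~~ c (v 0))| <= t.
Proof.
move=> mt; have odds : #|[set v i.*2.+1 | i : 'I_t]| <= t.
  by rewrite -[leqRHS]card_ord leq_imset_card.
apply: leq_trans odds; apply: subset_leq_card; apply/subsetP => y; rewrite inE => /andP[yp cy].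
have im : index y p < m by rewrite index_mem.
have := path_colour x0 gp im; rewrite nth_index // (eqP cy) => E.
have oi : odd (index y p) by case: (c _) E; case: odd.
have it : (index y p)./2 < t by clear -im oi mt; lia.
apply/imsetP; exists (Ordinal it) => //=.
by rewrite (_ : _.*2.+1 = index y p) ?nth_index //; clear -oi; lia.
Qed.

Lemma on_path_same t : m <= t.*2 -> #|on_path (c (v 0))| <= t.
Proof.
move=> mt; apply: leq_trans (card_even_positions t).
apply: subset_leq_card; apply/subsetP => y; rewrite inE => /andP[yp cy].
have im : index y p < m by rewrite index_mem.
have := path_colour x0 gp im; rewrite nth_index // (eqP cy) => E.
rewrite -[y](nth_index x0 yp) mem_even_positions //; first exact: leq_trans im mt.
by case: (c _) E; case: odd.
Qed.

Lemma on_path_card b : #|on_path b| + #|on_path (~~ b)| = m.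
Proof.
have <- : #|[set y in p]| = m by rewrite cardsE; apply/card_uniqP.
rewrite -(cardsID [set y | c y == b] [set y in p]); congr (_ + _).
  by apply: eq_card => y; rewrite !inE.
by apply: eq_card => y; rewrite !inE andbC; case: (c y); case: (b).
Qed.

Lemma off_path b : #|on_path b| < #|part b| -> exists2 u, u \in part b & u \notin p.
Proof.
move=> lt; have [/existsP[u /andP[uB up']]|] := boolP [exists u, (u \in part b) && (u \notin p)].
  by exists u.
rewrite negb_exists => /forallP all; move: lt; rewrite ltnNge => /negP[].
apply: subset_leq_card; apply/subsetP => u uB; have := all u.
by rewrite uB negbK inE => ->; move: uB; rewrite inE => /andP[].
Qed.

Lemma part_split b : #|part b| = #|on_path b| + #|part b :\: [set y in p]|.
Proof.
rewrite -(cardsID [set y in p]) ; congr (_ + _); apply: eq_card => y; rewrite !inE.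
have [yp|] := boolP (y \in p); last by rewrite andbF.
by rewrite andbT -[y](nth_index x0 yp) path_in // index_mem.
Qed.

(** An odd path with both ends coloured false has one more false vertex than true
    ones, so off p the true vertices are in strict majority.  Hence a
    depth-first search off p, started next to p, has a leaf coloured true. *)
Lemma branch_exists t : m = t.*2.+1 -> c (v 0) = false ->
  #|part false| <= #|part true| -> t < #|part true| ->
  exists q j, [/\ gpath e q, ~~ has (mem p) q & 0 < size q] /\
    [/\ j < m, e (v j) (head x0 q), last x0 q \in part true &
      forall y, e (last x0 q) y -> y \in p ++ q].
Proof.
move=> mt c0 AB tB.
have pB : #|on_path true| <= t.
  by have := @on_path_opposite t; rewrite mt c0 => /(_ (leqnn _)).
have pA := on_path_card true; rewrite /= in pA.
pose S := V :\: [set y in p].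
pose att y := [exists x, (x \in p) && e x y].
have SA : S :\: [set x | c x] = part false :\: [set y in p].
  by apply/setP => y; rewrite !inE; case: (c y); rewrite ?andbF ?andbT.
have SB : S :&: [set x | c x] = part true :\: [set y in p].
  by apply/setP => y; rewrite !inE; case: (c y); rewrite ?andbF ?andbT.
have [||z [q [az gq sq lq nq]]] := leaf_exists e_sym e_col (att := att) (leqnn #|S|).
- move=> y; rewrite inE => /andP[yp yV].
  pose P y := (y \in p) || [exists z, [&& z \in S, att z & connect (within e S) z y]].
  have : P y.
    apply: (@closed_all P (v 0)) yV => [||u w euw].
    - exact: path_in (ltnW p2).
    - by rewrite /P mem_nth // ltnW.
    rewrite /P; have [//|wp] := boolP (w \in p).
    have wS : w \in S.
      by rewrite !inE wp (bip_in G (y := u)) // e_sym.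
    have [up' _|up' /= /existsP[z /and3P[zS az zu]]] := boolP (u \in p).
      apply/existsP; exists w; rewrite wS connect0 andbT.
      by apply/existsP; exists u; rewrite up'.
    apply/existsP; exists z; rewrite zS az (connect_trans zu) // connect1 //=.
    by rewrite euw wS !inE up' (bip_in G euw).
  rewrite inE in yp.
  by rewrite /P (negbTE yp) => /existsP[z /and3P[zS az zy]]; exists z.
- have sA := part_split false; have sB := part_split true.
  by left; rewrite SA SB; clear -AB pB pA mt sA sB; lia.
have /existsP[x /andP[xp exz]] := az.
exists (z :: q), (index x p); split; split => //.
- by apply/hasPn => y /sq; rewrite !inE => /andP[].
- by rewrite index_mem.
- by rewrite nth_index.
- have /sq := mem_last z q; rewrite [last x0 _]/= !inE => /andP[_ ->].
  by rewrite lq.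
move=> y ely; rewrite mem_cat; have [//|yp] := boolP (y \in p).
by apply: nq => //; rewrite !inE yp (bip_in G (y := last z q)) // e_sym.
Qed.

End LongestPath.
End Bipartite.

(** * Deleting one or two vertices *)

Section Colours.
Variables (T : finType) (V : {set T}) (e : rel T).
Implicit Types (c : pred T).

Lemma bip_swap c c' : (forall x, c' x = ~~ c x) -> bipgraph V e c -> bipgraph V e c'.
Proof.
move=> cc [sym col inV con]; split => // x y exy.
by rewrite !cc (col _ _ exy).
Qed.

Lemma part_swap c c' b : (forall x, c' x = ~~ c x) -> part V c' b = part V c (~~ b).
Proof.
by move=> cc; apply/setP => x; rewrite !inE cc; case: (c x); case: b.
Qed.

Lemma nonedges_swap c c' : (forall x, c' x = ~~ c x) -> symmetric e ->
  #|nonedges V e c'| <= #|nonedges V e c|.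
Proof.
move=> cc sym; pose swap (xy : T * T) := (xy.2, xy.1).
have swap_inj : injective swap by move=> [x y] [x' y'] [-> ->].
rewrite -(card_imset _ swap_inj).
apply: subset_leq_card; apply/subsetP => _ /imsetP[[x y] xy ->].
move: xy; rewrite !inE /= !cc sym.
by case/and3P=> /andP[-> +] /andP[-> +] ->; case: (c x); case: (c y).
Qed.

Definition edge_pairs c := [set xy : T * T | [&& ~~ c xy.1, c xy.2 & e xy.1 xy.2]].

Lemma card_edge_pairs c : bipgraph V e c ->
  #|edge_pairs c| + #|nonedges V e c| = #|part V c false| * #|part V c true|.
Proof.
move=> [sym col inV con]; rewrite -cardsX -(cardsID (edge_pairs c) (setX _ _)).
congr (_ + _); apply: eq_card => -[x y].
  rewrite !inE /=; case exy: (e x y); rewrite ?andbF ?andbT //.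
  rewrite (inV _ _ exy) (inV y x) ?[e y x]sym //=.
  by case: (c x); case: (c y).
rewrite !inE /= -!andbA.
by case: (x \in V); case: (y \in V); case: (c x); case: (c y); case: (e x y).
Qed.

(** Each lost edge is charged to an end of it in D. *)
Lemma edge_pairs_del c (D : {set T}) : symmetric e ->
  #|edge_pairs c| <= #|[set xy in edge_pairs c | (xy.1 \notin D) && (xy.2 \notin D)]|
    + \sum_(d in D) #|nbr e d|.
Proof.
move=> sym; pose F d := (fun y => if c d then (y, d) else (d, y)) @: nbr e d.
have FU : #|\bigcup_(d in D) F d| <= \sum_(d in D) #|nbr e d|.
  elim/big_rec2: _ => [|d n X _ IH]; first by rewrite cards0.
  apply: leq_trans (leq_card_setU _ _) _.
  by rewrite leq_add ?leq_imset_card.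
apply: leq_trans (leq_add (leqnn _) FU); apply: leq_trans (leq_card_setU _ _).
apply: subset_leq_card; apply/subsetP => -[x y]; rewrite !inE /= => /and3P[cx cy exy].
rewrite cx cy exy /=; have [xD|/= xD] := boolP (x \in D).
  apply/bigcupP; exists x => //; apply/imsetP; exists y; first by rewrite inE.
  by rewrite (negbTE cx).
have [yD|//] := boolP (y \in D).
apply/bigcupP; exists y => //; apply/imsetP; exists x; first by rewrite inE sym.
by rewrite cy.
Qed.

End Colours.

Lemma edge_pairs_of_del (T : finType) (e : rel T) (c : pred T) (D : {set T}) :
  [set xy in edge_pairs e c | (xy.1 \notin D) && (xy.2 \notin D)]
    = edge_pairs (del e D) c.
Proof.
apply/setP => -[x y]; rewrite !inE /=.
by case: (c x); case: (c y); case: (e x y); rewrite /= ?andbF ?andbT.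
Qed.

Lemma part_del (T : finType) (V D : {set T}) (c : pred T) b :
  part (V :\: D) c b = part V c b :\: D.
Proof. by apply/setP => x; rewrite !inE andbA. Qed.

Section Deletion.
Variables (T : finType) (e : rel T) (V : {set T}) (c : pred T) (k : nat).
Hypothesis G : bipgraph V e c.
Hypothesis small_paths : forall q, gpath e q -> size q < k.*2.
Let e_sym := bip_sym G.
Let e_col := bip_col G.

(** An even path can be reversed, so its first vertex may be taken of colour
    false. *)
Lemma longest_exists x y : e x y ->
  exists x0 p, [/\ longest e p, 1 < size p & odd (size p) \/ c (nth x0 p 0) = false].
Proof.
move=> exy; pose P n := [exists q : n.-tuple T, gpath e q].
have P2 : P 2.
  apply/existsP; exists [tuple x; y]; rewrite /gpath /= exy inE !andbT.
  by apply/eqP => xy; have := e_col exy; rewrite xy; case: (c y).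
have Pb n : P n -> n <= k.*2.
  by case/existsP=> q /small_paths; rewrite size_tuple; exact: ltnW.
have [n /existsP[p gp] max] := ex_maxnP (ex_intro _ 2 P2) Pb.
have lp : longest e p.
  split=> // q gq; rewrite size_tuple; apply: max; apply/existsP.
  by exists (in_tuple q).
have p2 : 1 < size p by rewrite size_tuple max.
have [op|ep] := boolP (odd (size p)); first by exists x, p; split => //; left.
have [cx|cx] := boolP (c (nth x p 0)); last by exists x, p; split => //; right; exact: negbTE.
exists x, (rev p); rewrite size_rev; split => //; first exact: longest_rev.
right; rewrite nth_rev ?(ltnW p2) // subn1.
have [gp' _] := lp; rewrite (path_colour G) //; last by rewrite prednK // ltnW.
by rewrite cx addTb; clear -p2 ep; lia.
Qed.

Lemma edge_exists : 0 < #|part V c false| -> 0 < #|part V c true| ->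
  exists x y, e x y.
Proof.
case/card_gt0P=> x; rewrite inE => /andP[xV /eqP cx].
case/card_gt0P=> y; rewrite inE => /andP[yV /eqP cy].
have xy : y != x by apply/eqP => E; rewrite E cx in cy.
have /card_gt0P[z] := nbr_nonempty G xV yV xy.
by rewrite inE; exists x, z.
Qed.

Section WithPath.
Variables (x0 : T) (p : seq T).
Hypothesis lp : longest e p.
Hypothesis p2 : 1 < size p.
Hypothesis kA : k <= #|part V c false|.
Hypothesis kB : k <= #|part V c true|.
Local Notation v := (nth x0 p).
Local Notation m := (size p).

Let mk : m < k.*2. Proof. by have [gp _] := lp; exact: small_paths. Qed.

Lemma off_both t : m <= t.*2.+1 -> t < k ->
  exists2 u, u \in part V c (~~ c (v 0)) & u \notin p.
Proof.
move=> mt tk; apply: (off_path (c := c) (V := V)).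
apply: leq_ltn_trans (on_path_opposite G x0 lp mt) _.
by apply: leq_trans tk _; case: (c _).
Qed.

Lemma first_degree_gt0 : 0 < #|nbr e (v 0)|.
Proof.
apply/card_gt0P; exists (v 1); rewrite inE; have [gp _] := lp.
exact: gpath_step.
Qed.

Lemma even_reduction : ~~ odd m -> c (v 0) = false ->
  [/\ v 0 \in part V c false, v m.-1 \in part V c true,
      #|nbr e (v 0)| + #|nbr e (v m.-1)| < k &
      forall D : {set T}, D \subset [set v 0; v m.-1] ->
        bipgraph (V :\: D) (del e D) c].
Proof.
move=> em c0; have [gp _] := lp; have up : uniq p by case/andP: gp.
have mt : m = m./2.*2 by clear -em; lia.
have tk : m./2 < k by clear -mk; lia.
have lm : m.-1 < m by rewrite prednK // ltnW.
have [|u uP up'] := @off_both m./2 _ tk; first by clear; lia.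
have uV : u \in V by move: uP; rewrite inE => /andP[].
split.
- by rewrite inE c0 eqxx andbT (path_in G x0 lp p2) // ltnW.
- rewrite inE (path_in G x0 lp p2 lm) (path_colour G x0 gp lm) c0 addFb.
  by clear -em p2; lia.
- exact: leq_ltn_trans (even_ends_degree G x0 lp p2 mt uV up') tk.
move=> D DE; apply: (bip_del_ends G lp p2 (x0 := x0)).
- exact: (longest_gt2 G x0 lp p2 uV up').
- move=> i im /(subsetP DE); rewrite !inE !nth_uniq // ?(ltnW p2) //.
  by case/orP=> /eqP; [left | right].
- move=> d y /(subsetP DE); rewrite !inE => /orP[]/eqP-> _.
    exact: (longest_end e_sym lp (ltnW p2)).
  exact: (longest_last e_sym lp (ltnW p2)).
Qed.

Lemma odd_reduction_small : odd m -> c (v 0) = false ->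
  #|part V c false| <= #|part V c true| ->
  exists x, [/\ v 0 \in part V c false, x \in part V c true,
      #|nbr e (v 0)| + #|nbr e x| < k &
      forall D : {set T}, x \in D -> D \subset [set x; v 0] ->
        bipgraph (V :\: D) (del e D) c].
Proof.
move=> om c0 AB; have [gp _] := lp.
have mt : m = m./2.*2.+1 by clear -om; lia.
have tk : m./2 < k by clear -mk; lia.
have [|u uP up'] := @off_both m./2 _ tk; first by clear; lia.
have uV : u \in V by move: uP; rewrite inE => /andP[].
have [q [j [[gq dis q0] [jm ejq cx nx]]]] :=
  branch_exists G lp p2 mt c0 AB (leq_trans tk kB).
exists (last x0 q); split.
- by rewrite inE c0 eqxx andbT (path_in G x0 lp p2) // ltnW.
- exact: cx.
- apply: leq_ltn_trans (odd_ends_degree G lp p2 (x0 := x0) mt gq dis q0 jm ejq _ nx) tk.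
  by move: cx; rewrite inE => /andP[_ /eqP->]; rewrite c0.
- move=> D xD DE; apply: (bip_del_branch G lp p2 (x0 := x0) _ gq dis q0 jm ejq nx xD DE).
  exact: (longest_gt2 G x0 lp p2 uV up').
Qed.

Lemma odd_reduction_large : odd m -> c (v 0) = true ->
  [/\ v 0 \in part V c true, #|nbr e (v 0)| < k.-1 &
    bipgraph (V :\: [set v 0]) (del e [set v 0]) c].
Proof.
move=> om c0; have [gp _] := lp; have up : uniq p by case/andP: gp.
have mt : m = m./2.*2.+1 by clear -om; lia.
have tk : m./2 < k by clear -mk; lia.
have [|u uP up'] := @off_both m./2 _ tk; first by clear; lia.
move: uP; rewrite inE => /andP[uV cu].
split.
- by rewrite inE c0 eqxx andbT (path_in G x0 lp p2) // ltnW.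
- have := first_degree_lt G lp p2 (x0 := x0) mt uV up'.
  rewrite (eqP cu) => /(_ _) lt; have : #|nbr e (v 0)| < m./2 by apply: lt; case: (c _).
  by clear -tk; lia.
apply: (bip_del_ends G lp p2 (x0 := x0)).
- exact: (longest_gt2 G x0 lp p2 uV up').
- by move=> i im; rewrite inE nth_uniq // ?(ltnW p2) // => /eqP; left.
- by move=> d y; rewrite inE => /eqP-> _; apply: (longest_end e_sym lp (ltnW p2)).
Qed.

End WithPath.
End Deletion.

(** Deleting a true vertex decreases the bound by k - 2, and deleting a false one
    decreases it by 1; r counts the false vertices deleted. *)
Lemma bound_step k b a r d E E' : 2 < k -> 0 < b -> d < k.-1 + r ->
  E <= E' + d -> E' <= (k - 2) * (b - 1) + a -> E <= (k - 2) * b + (a + r).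
Proof.
case: b => // b; rewrite subn1 mulnS /=.
by move: (_ * b) => x; lia.
Qed.

Section Reduction.
Variables (T : finType) (k : nat).
Implicit Types (V : {set T}) (e : rel T) (c : pred T).
Hypothesis k3 : 2 < k.

(** The vertex to delete is the true end of an even path, the end of the branch
    of an odd path with false ends, or an end of an odd path with true ends.  In
    the first two cases its degree plus the positive degree of another vertex
    is less than k. *)
Lemma step_lt V e c : bipgraph V e c -> (forall q, gpath e q -> size q < k.*2) ->
  k <= #|part V c false| -> #|part V c false| < #|part V c true| ->
  exists y, [/\ y \in part V c true, #|nbr e y| < k.-1 &
    bipgraph (V :\: [set y]) (del e [set y]) c].
Proof.
move=> G sp kA AB; have kB := leq_trans kA (ltnW AB).
have [|| a [b /(longest_exists G sp)[x0 [p [lp p2 oc]]]]] := edge_exists G.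
- by apply: leq_trans kA; clear -k3; lia.
- by apply: leq_trans kB; clear -k3; lia.
have d0 := first_degree_gt0 x0 lp p2.
have [op|ep] := boolP (odd (size p)); last first.
  have c0 : c (nth x0 p 0) = false by case: oc ep => // ->.
  have [_ lB deg D] := even_reduction G sp lp p2 kA kB ep c0.
  exists (nth x0 p (size p).-1); split => //; first by clear -d0 deg; lia.
  by apply: D; rewrite sub1set !inE eqxx orbT.
case c0: (c (nth x0 p 0)).
  have [v0B deg D] := odd_reduction_large G sp lp p2 kA kB op c0.
  by exists (nth x0 p 0).
have [x [_ xB deg D]] := odd_reduction_small G sp lp p2 kA kB op c0 (ltnW AB).
exists x; split => //; first by clear -d0 deg; lia.
by apply: D; rewrite ?inE // sub1set !inE eqxx.
Qed.

(** The two classes have the same size, so in the case of an odd path with true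
    ends the colours can be exchanged. *)
Lemma step_eq V e c : bipgraph V e c -> (forall q, gpath e q -> size q < k.*2) ->
  k <= #|part V c false| -> #|part V c false| = #|part V c true| ->
  exists x y, [/\ x \in part V c false, y \in part V c true,
    #|nbr e x| + #|nbr e y| < k &
    bipgraph (V :\: [set x; y]) (del e [set x; y]) c].
Proof.
move=> G sp kA AB; have kB : k <= #|part V c true| by rewrite -AB.
have [|| a [b /(longest_exists G sp)[x0 [p [lp p2 oc]]]]] := edge_exists G.
- by apply: leq_trans kA; clear -k3; lia.
- by apply: leq_trans kB; clear -k3; lia.
have [op|ep] := boolP (odd (size p)); last first.
  have c0 : c (nth x0 p 0) = false by case: oc ep => // ->.
  have [vA lB deg D] := even_reduction G sp lp p2 kA kB ep c0.
  by exists (nth x0 p 0), (nth x0 p (size p).-1); split => //; apply: D.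
case c0: (c (nth x0 p 0)); last first.
  have [x [vA xB deg D]] := odd_reduction_small G sp lp p2 kA kB op c0 (eq_leq AB).
  exists (nth x0 p 0), x; split => //; apply: D; first by rewrite !inE eqxx orbT.
  by rewrite setUC.
have cc x : (predC c) x = ~~ c x by [].
have G' := bip_swap cc G.
have pF : part V (predC c) false = part V c true by rewrite (part_swap _ _ cc).
have pT : part V (predC c) true = part V c false by rewrite (part_swap _ _ cc).
have c0' : (predC c) (nth x0 p 0) = false by rewrite /= c0.
have := odd_reduction_small G' sp lp p2; rewrite pF pT => /(_ x0 kB kA op c0' (eq_leq (esym AB))).
case=> x [vB xA deg D]; exists x, (nth x0 p 0); split => //.
  by rewrite addnC.
have c' y : c y = ~~ (predC c) y by rewrite /= negbK.
by apply: (bip_swap c'); apply: D => //; rewrite !inE eqxx.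
Qed.

Lemma nonedges_balanced V e c : bipgraph V e c ->
  (forall q, gpath e q -> size q < k.*2) ->
  #|part V c false| = k -> #|part V c true| = k ->
  k.*2 <= #|nonedges V e c| + 2.
Proof.
move=> G sp kA kB.
have [|| a [b /(longest_exists G sp)[x0 [p [lp p2 oc]]]]] := edge_exists G.
- by rewrite kA; clear -k3; lia.
- by rewrite kB; clear -k3; lia.
have gp : gpath e p by case: lp.
have mk := sp p gp; have tk : (size p)./2 < k by clear -mk; lia.
have mt : size p <= (size p)./2.*2.+1 by clear; lia.
have kA' : k <= #|part V c false| by rewrite kA.
have kB' : k <= #|part V c true| by rewrite kB.
have [w wP wp] := off_both G x0 lp kA' kB' mt tk.
have [op|ep] := boolP (odd (size p)); last first.
  have c0 : c (nth x0 p 0) = false by case: oc ep => // ->.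
  rewrite c0 in wP.
  have [u uA up] : exists2 u, u \in part V c false & u \notin p.
    apply: off_path; rewrite kA; apply: leq_ltn_trans tk.
    rewrite -[X in on_path _ _ X]c0; apply: (on_path_same G x0 lp p2).
    by clear -ep; lia.
  exact: (nonedges_even G lp p2 ep c0 kA kB uA up wP wp).
case c0: (c (nth x0 p 0)); last first.
  by rewrite c0 in wP; exact: (nonedges_odd G lp p2 op c0 kA kB wP wp).
have cc x : (predC c) x = ~~ c x by [].
have G' := bip_swap cc G.
apply: leq_trans (leq_add (nonedges_swap V cc (bip_sym G)) (leqnn 2)).
apply: (nonedges_odd (x0 := x0) G' lp p2 op (w := w)); rewrite ?(part_swap _ _ cc) //=.
  by rewrite c0.
by rewrite c0 in wP.
Qed.

Lemma gpath_del e (D : {set T}) q : gpath (del e D) q -> gpath e q.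
Proof.
case/andP=> uq oq; rewrite /gpath uq /=; apply: sub_sorted oq => x y.
by case/and3P.
Qed.

(** Induction on the larger class.  While the classes differ in size, a true vertex
    of degree at most k - 2 is deleted; while they have the same size, larger
    than k, a vertex of each class, of degrees adding up to at most k - 1.  Both
    steps match the decrease of the bound, and they end in two classes of size
    k, where k^2 - (2 k - 2) = (k - 2) (k - 1) + k. *)
Lemma edge_bound V e c : bipgraph V e c ->
  (forall q, gpath e q -> size q < k.*2) ->
  k <= #|part V c false| <= #|part V c true| ->
  #|edge_pairs e c| <= (k - 2) * (#|part V c true| - 1) + #|part V c false|.
Proof.
have [n] := ubnP #|part V c true|; elim: n V e => // n IH V e Bn G sp /andP[kA AB].
have [eqAB|ltAB] := eqVneq #|part V c false| #|part V c true|; last first.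
  have {}ltAB : #|part V c false| < #|part V c true| by rewrite ltn_neqAle ltAB.
  have [y [yB deg G']] := step_lt G sp kA ltAB.
  have pA : part (V :\: [set y]) c false = part V c false.
    rewrite part_del; apply/setDidPl; rewrite disjoint_sym disjoints1 inE.
    by move: yB; rewrite inE => /andP[_ /eqP->]; rewrite andbF.
  have pB : #|part V c true| = #|part (V :\: [set y]) c true|.+1.
    by rewrite part_del (cardsD1 y) yB.
  have := edge_pairs_del c [set y] (bip_sym G); rewrite big_set1.
  have /(_ _ G') := IH (V :\: [set y]) (del e [set y]).
  rewrite pA => IH' le; have {IH'} := IH' _ (fun q gq => sp q (gpath_del gq)).
  have b1 : #|part (V :\: [set y]) c true| < n by clear -Bn pB; lia.
  move=> /(_ b1); rewrite kA /= -ltnS -pB => /(_ ltAB).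
  have b0 : 0 < #|part (V :\: [set y]) c true| by clear -pB kA ltAB k3; lia.
  rewrite edge_pairs_of_del in le; rewrite -[k.-1]addn0 in deg.
  by move/(bound_step k3 b0 deg le); rewrite addn0 pB subn1.
have [eqk|ltk] := eqVneq #|part V c false| k.
  have N := nonedges_balanced G sp eqk (etrans (esym eqAB) eqk).
  have := card_edge_pairs G; rewrite -eqAB eqk.
  by clear -N k3; nia.
have [x [y [xA yB deg G']]] := step_eq G sp kA eqAB.
have xy : x != y.
  by move: xA yB; rewrite !inE => /andP[_ /eqP cx] /andP[_ cy]; apply: contraTneq cy => <-; rewrite cx.
have pA : #|part V c false| = #|part (V :\: [set x; y]) c false|.+1.
  rewrite part_del (cardsD1 x) xA; congr _.+1; apply: eq_card => z; rewrite !inE.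
  move: yB; rewrite !inE => /andP[_ /eqP cy]; have [->|] := eqVneq z y; first by rewrite cy /= !andbF.
  by rewrite orbF.
have pB : #|part V c true| = #|part (V :\: [set x; y]) c true|.+1.
  rewrite part_del (cardsD1 y) yB; congr _.+1; apply: eq_card => z; rewrite !inE.
  move: xA; rewrite !inE => /andP[_ /eqP cx]; have [->|] := eqVneq z x; first by rewrite cx /= !andbF.
  by [].
have := edge_pairs_del c [set x; y] (bip_sym G).
rewrite big_setU1 ?big_set1 ?inE // edge_pairs_of_del => le.
have b1 : #|part (V :\: [set x; y]) c true| < n by clear -Bn pB; lia.
have := IH _ _ b1 G' (fun q gq => sp q (gpath_del gq)).
have -> : k <= #|part (V :\: [set x; y]) c false| <= #|part (V :\: [set x; y]) c true|.
  by apply/andP; split; clear -pA pB eqAB ltk kA; lia.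
have b0 : 0 < #|part (V :\: [set x; y]) c true| by clear -pB pA kA eqAB k3; lia.
have deg' : #|nbr e x| + #|nbr e y| < k.-1 + 1 by rewrite addn1 prednK // (ltn_trans _ k3).
by move=> /(_ isT) /(bound_step k3 b0 deg' le); rewrite addn1 -pA pB subn1.
Qed.

End Reduction.

(** * Graphs given by edge sets *)

Lemma adj_sym (T : finType) (G : sgraph T) : symmetric (adj G).
Proof. by move=> x y; rewrite /adj setUC. Qed.

Lemma adj_path_graph n (i j : 'I_n) :
  adj (path_graph n) i j = (j == i.+1 :> nat) || (i == j.+1 :> nat).
Proof.
apply/imsetP/orP => [[[x y]]|ij]; last first.
  case: ij => ij; first by exists (i, j); rewrite ?inE.
  by exists (j, i); rewrite ?inE //= setUC.
rewrite inE /= => /eqP xy E.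
have xE : x \in [set i; j] by rewrite E !inE eqxx.
have yE : y \in [set i; j] by rewrite E !inE eqxx orbT.
move: xE yE xy; rewrite !inE => /orP[]/eqP-> /orP[]/eqP-> xy; lia.
Qed.

Lemma contains_path (T : finType) (G : sgraph T) q :
  gpath (adj G) q -> contains (path_graph (size q)) G.
Proof.
case/andP=> uq oq; apply/existsP; exists [ffun i => tnth (in_tuple q) i].
apply/andP; split.
  by apply/injectiveP => i j; rewrite !ffunE => /(tuple_uniqP (in_tuple q) uq).
have step (i j : 'I_(size q)) : j = i.+1 :> nat ->
    adj G (tnth (in_tuple q) i) (tnth (in_tuple q) j).
  move=> ij; have x0 := tnth (in_tuple q) i.
  rewrite !(tnth_nth x0) ij; move/(sortedP x0): oq; apply.
  by rewrite -ij.
apply/forallP => i; apply/forallP => j; apply/implyP.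
rewrite adj_path_graph !ffunE => /orP[]/eqP ij; first exact: step.
by rewrite adj_sym step.
Qed.

Lemma path_of_contains (T : finType) (G : sgraph T) n :
  contains (path_graph n) G -> exists2 q, gpath (adj G) q & size q = n.
Proof.
case/existsP=> f /andP[/injectiveP injf /forallP homf].
exists (map f (enum 'I_n)); last by rewrite size_map size_enum_ord.
rewrite /gpath map_inj_uniq // enum_uniq sorted_map.
apply: (@sub_sorted _ (relpre val (fun i j => j == i.+1))) => [i j /= ij|].
  by have /forallP/(_ j)/implyP := homf i; apply; rewrite adj_path_graph ij.
rewrite -sorted_map val_enum_ord; elim: n 0 {f injf homf} => // -[|n] IH s //.
by rewrite /= eqxx; apply: (IH s.+1).
Qed.

Section Translation.
Variables (T : finType) (G : sgraph T) (A : {set T}).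
Hypothesis G_conn : Defs.connected G.
Hypothesis G_bip : forall x y, adj G x y -> (x \in A) != (y \in A).

Lemma sgraph_bipgraph : bipgraph setT (adj G) [pred x | x \notin A].
Proof.
split=> [|x y /G_bip|x y _|x y _ _]; [exact: adj_sym | | by rewrite inE |].
  by rewrite /=; case: (x \in A); case: (y \in A).
by case/andP: G_conn => _ /forallP/(_ x)/forallP/(_ y).
Qed.

Lemma card_edges_le : #|edges G| <= #|edge_pairs (adj G) [pred x | x \notin A]|.
Proof.
pose pair (xy : T * T) := [set xy.1; xy.2].
apply: leq_trans (leq_imset_card pair _); apply: subset_leq_card.
apply/subsetP => E EG; have := valP G; rewrite /= => /forall_inP/(_ E EG).
case/cards2P => x [y [_ EE]]; have xy : adj G x y by rewrite /adj -EE.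
have := G_bip xy; case xA: (x \in A); case yA: (y \in A) => // _.
  by apply/imsetP; exists (x, y); rewrite ?inE /= ?xA ?yA.
by apply/imsetP; exists (y, x); rewrite ?inE /= ?xA ?yA //= ?[adj G y x]adj_sym // EE setUC.
Qed.

End Translation.

Lemma ex_bc_upper k a b : 2 < k -> k <= a -> a <= b ->
  ex_bc a b (path_graph (2 * k)) <= (k - 2) * (b - 1) + a.
Proof.
move=> k3 ka ab; apply/bigmax_leqP => G /and3P[con /existsP[A /and3P[/eqP cA /eqP cB bip]] free].
have cross x y : adj G x y -> (x \in A) != (y \in A).
  by have /forallP/(_ x)/forallP/(_ y)/implyP := bip.
apply: leq_trans (card_edges_le cross) _.
have pA : part setT [pred x | x \notin A] false = A.
  by apply/setP => x; rewrite !inE eqbF_neg negbK.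
have pB : part setT [pred x | x \notin A] true = ~: A.
  by apply/setP => x; rewrite !inE eqb_id.
have := edge_bound k3 (sgraph_bipgraph con cross).
rewrite pA pB cA cB ka ab => /(_ _ isT); apply.
move=> q gq; rewrite ltnNge; apply: contra free => kq.
have -> : 2 * k = size (take k.*2 q) by rewrite size_takel // mul2n.
by apply: contains_path; exact: gpath_take.
Qed.

(** * The extremal graph *)

Lemma card_ord_lt n i : i <= n -> #|[set x : 'I_n | x < i]| = i.
Proof.
move=> le; have -> : [set x : 'I_n | x < i] = widen_ord le @: setT.
  apply/setP => x; rewrite inE; apply/idP/imsetP => [xi|[y _ ->]]; last exact: (ltn_ord y).
  by exists (Ordinal xi); rewrite ?inE //; apply: val_inj.
by rewrite card_imset ?cardsT ?card_ord // => x y /(congr1 val) /= /val_inj.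
Qed.

Section Extremal.
Variables (k a b : nat).
Hypotheses (k3 : 2 < k) (ka : k <= a) (ab : a <= b).

Lemma hub_proof : a < a + b.
Proof. by rewrite -[X in X < _]addn0 ltn_add2l; clear -k3 ka ab; lia. Qed.

Definition hub : 'I_(a + b) := Ordinal hub_proof.

(** The vertices below a form one class.  The first k - 2 of them are joined to
    the whole other class, and the others are pendant at the vertex hub. *)
Definition extremal_pairs : {set 'I_(a + b) * 'I_(a + b)} :=
  [set xy : 'I_(a + b) * 'I_(a + b) | (xy.1 < a <= xy.2) && ((xy.1 < k - 2) || (xy.2 == hub))].

Definition extremal_edges : {set {set 'I_(a + b)}} :=
  [set [set xy.1; xy.2] | xy in extremal_pairs].

Lemma extremal_simple : [forall E in extremal_edges, #|E| == 2].
Proof.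
apply/forall_inP => E /imsetP[[x y]]; rewrite inE /= => /andP[/andP[xa ay] _] ->.
by rewrite cards2 -val_eqE /= neq_ltn (leq_trans xa).
Qed.

Definition extremal : sgraph 'I_(a + b) := SGraph extremal_simple.

Lemma adj_extremal x y : adj extremal x y =
  ((x, y) \in extremal_pairs) || ((y, x) \in extremal_pairs).
Proof.
apply/imsetP/orP => [[[x' y'] xy E]|[]xy]; last 2 first.
- by exists (x, y).
- by exists (y, x); rewrite // setUC.
have := xy; rewrite inE /= => /andP[/andP[xa ay] _].
have xE : x' \in [set x; y] by rewrite E !inE eqxx.
have yE : y' \in [set x; y] by rewrite E !inE eqxx orbT.
have ne : x' != y' by rewrite -val_eqE /= neq_ltn (leq_trans xa).
move: xE yE ne xy; rewrite !inE => /orP[]/eqP-> /orP[]/eqP-> //; rewrite ?eqxx // => _ ->.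
  by left.
by right.
Qed.

Let A := [set x : 'I_(a + b) | x < a].

Lemma extremal_cross x y : adj extremal x y -> (x \in A) != (y \in A).
Proof.
rewrite adj_extremal !inE /= => /orP[]/andP[/andP[-> ay] _]; by rewrite ltnNge ay.
Qed.

Lemma extremal_connected : Defs.connected extremal.
Proof.
have k0 : 0 < k - 2 by rewrite subn_gt0.
have zp : 0 < a + b by apply: leq_ltn_trans hub_proof.
pose z : 'I_(a + b) := Ordinal zp.
have a0 : 0 < a by apply: leq_trans ka; clear -k3; lia.
have toA (x : 'I_(a + b)) : x < a -> adj extremal x hub.
  by move=> xa; rewrite adj_extremal !inE /= xa leqnn eqxx orbT.
have to x : connect (adj extremal) x hub.
  have [|ax] := ltnP x a; first by move/toA/connect1.
  apply: (connect_trans (y := z)); last exact/connect1/toA.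
  by apply: connect1; rewrite adj_extremal !inE /= ax a0 k0 orbT.
apply/andP; split; first by rewrite card_ord.
apply/forallP => x; apply/forallP => y; apply: connect_trans (to x) _.
by rewrite (sym_connect_sym (@adj_sym _ extremal)).
Qed.

Lemma extremal_sizes : bipartite_sizes a b extremal.
Proof.
apply/existsP; exists A; rewrite card_ord_lt ?leq_addr // eqxx /=.
have := cardsC A; rewrite card_ord_lt ?leq_addr // card_ord => /addnI->.
rewrite eqxx /=; apply/forallP => x; apply/forallP => y; apply/implyP.
exact: extremal_cross.
Qed.

Lemma extremal_card : #|edges extremal| = (k - 2) * (b - 1) + a.
Proof.
rewrite /= card_in_imset; last first.
  move=> [x y] [x' y']; rewrite !inE /= => /andP[/andP[xa ay] _] /andP[/andP[xa' ay'] _] E.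
  have xE : x \in [set x'; y'] by rewrite -E !inE eqxx.
  have yE : y \in [set x'; y'] by rewrite -E !inE eqxx orbT.
  have ne (u w : 'I_(a + b)) : u < a -> a <= w -> u != w.
    by move=> ua aw; rewrite -val_eqE /= neq_ltn (leq_trans ua).
  move: xE; rewrite !inE (negbTE (ne _ _ xa ay')) orbF => /eqP->.
  by move: yE; rewrite !inE eq_sym (negbTE (ne _ _ xa' ay)) => /eqP->.
pose H := [set x : 'I_(a + b) | x < k - 2].
have HA : H \subset A.
  by apply/subsetP => x; rewrite !inE => /leq_trans; apply; clear -ka; lia.
have -> : extremal_pairs = setX H (~: A) :|: setX (A :\: H) [set hub].
  apply/setP => -[x y]; rewrite !inE /= -!leqNgt.
  have [xk|xk] := ltnP x (k - 2); rewrite ?andbT ?andbF ?orbF /=.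
    by rewrite (leq_trans xk) //; clear -ka; lia.
  by case: eqP => [->|_]; rewrite /= ?leqnn ?andbT ?andbF.
have cH : #|H| = k - 2 by rewrite card_ord_lt //; clear -ka; lia.
have cA : #|A| = a by rewrite card_ord_lt // leq_addr.
have cAC : #|~: A| = b by have := cardsC A; rewrite cA card_ord => /addnI.
have dis : setX H (~: A) :&: setX (A :\: H) [set hub] = set0.
  by apply/setP => -[x y]; rewrite !inE; case: (x < k - 2); rewrite /= ?andbF.
rewrite cardsU dis cards0 subn0 !cardsX cAC cards1 muln1 cardsD (setIidPr HA) cA cH.
case: (b) (leq_trans ka ab) => [|b' _]; first by clear -k3; lia.
by rewrite subn1 mulnS /=; move: (_ * b') => X; clear -k3 ka; lia.
Qed.

Lemma extremal_nbr x y : adj extremal x y -> x < a -> (x < k - 2) || (y == hub).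
Proof.
rewrite adj_extremal !inE /= => /orP[/andP[_]//|/andP[/andP[_ ax] _]].
by rewrite ltnNge ax.
Qed.

(** A path on 2 k - 1 vertices alternates between the classes, and its inner
    vertices below a have two neighbours, so they are among the k - 2 vertices
    that are not pendant.  If the ends are in the other class, there are k - 1
    such inner vertices, too many.  If the ends are below a, there are k - 2, so
    both ends are pendant, and the second vertex and the last but one are both
    the hub. *)
Lemma extremal_free : ~~ contains (path_graph (2 * k - 1)) extremal.
Proof.
apply/negP => /path_of_contains[q gq sq].
have G := sgraph_bipgraph extremal_connected extremal_cross.
have uq : uniq q by case/andP: gq.
pose v := nth hub q.
have pigeon o : o <= 2 -> (forall i, i < k - 1 -> v (i.*2 + o) < k - 2) -> False.
  move=> o2 small; pose f (i : 'I_(k - 1)) := v (i.*2 + o).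
  have injf : injective f.
    have io (i : 'I_(k - 1)) : i.*2 + o < size q.
      by rewrite sq; have := ltn_ord i; clear -o2 k3; lia.
    move=> i j /eqP; rewrite nth_uniq //.
    by move/eqP => E; apply: val_inj => /=; clear -E; lia.
  have : #|f @: setT| <= #|[set x : 'I_(a + b) | x < k - 2]|.
    apply: subset_leq_card; apply/subsetP => _ /imsetP[i _ ->].
    by rewrite inE small.
  rewrite card_imset // cardsT card_ord card_ord_lt; last by clear -ka; lia.
  by clear -k3; lia.
have col i : i < size q -> (v i < a) = ~~ odd i (+) ~~ (v 0 < a).
  move=> iq; have := path_colour G hub gq iq; rewrite /= !inE.
  by rewrite -/(v i) -/(v 0); case: (v i < a); case: (v 0 < a); case: odd.
have step i : i.+1 < size q -> adj extremal (v i) (v i.+1) by exact: gpath_step.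
have inner i : 0 < i -> i.+1 < size q -> v i < a -> v i < k - 2.
  case: i => // i _ iq ia; have e1 := step _ iq; have e2 := step _ (ltnW iq).
  have /orP[//|/eqP h1] := extremal_nbr e1 ia.
  rewrite adj_sym in e2; have /orP[//|/eqP h2] := extremal_nbr e2 ia.
  have /eqP : v i = v i.+2 by rewrite h1 h2.
  have i0 : i < size q := ltnW (ltnW iq).
  by rewrite nth_uniq // => /eqP; clear; lia.
have lq : 4 < size q by rewrite sq; clear -k3; lia.
have [v0|v0] := boolP (v 0 < a); last first.
  apply: (pigeon 1) => // i ik; apply: inner; rewrite ?addn1 //.
    by rewrite sq; clear -ik; lia.
  by rewrite col ?v0 /= ?odd_double // sq; clear -ik; lia.
have end0 : v 1 = hub.
  have e0 : adj extremal (v 0) (v 1) by apply: step; clear -lq; lia.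
  have /orP[v0k|/eqP//] := extremal_nbr e0 v0.
  case: (pigeon 0) => // -[//|i] ik; apply: inner.
  - by clear; lia.
  - by rewrite sq; clear -ik; lia.
  - by rewrite col ?v0 /= addn0 ?odd_double // sq; clear -ik; lia.
have end1 : v (2 * k - 3) = hub.
  have l1 : 2 * k - 2 = (2 * k - 3).+1 by clear -k3; lia.
  have l2 : (2 * k - 3).+1 < size q by rewrite sq; clear -k3; lia.
  have va : v (2 * k - 3).+1 < a.
    by rewrite col // v0 -l1 addbF; clear -k3; lia.
  have e1 := step _ l2; rewrite adj_sym in e1.
  have /orP[vk|/eqP//] := extremal_nbr e1 va.
  case: (pigeon 2) => // i ik; have [->|ne] := eqVneq i (k - 2).
    by rewrite (_ : _ + 2 = (2 * k - 3).+1) //; clear -k3; lia.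
  apply: inner.
  - by clear; lia.
  - by rewrite sq; clear -ik ne; lia.
  - by rewrite col ?v0 /= ?addn2 /= ?odd_double // sq; clear -ik; lia.
have /eqP : v 1 = v (2 * k - 3) by rewrite end0 end1.
by rewrite nth_uniq ?sq //; clear -k3; lia.
Qed.

Lemma ex_bc_lower : (k - 2) * (b - 1) + a <= ex_bc a b (path_graph (2 * k - 1)).
Proof.
rewrite -extremal_card; apply: (@leq_bigmax_cond _ _ (fun G => #|edges G|)).
by rewrite extremal_connected extremal_sizes extremal_free.
Qed.

End Extremal.

Lemma ex_bc_mono a b n n' : n <= n' ->
  ex_bc a b (path_graph n) <= ex_bc a b (path_graph n').
Proof.
move=> nn'; apply/bigmax_leqP => G /and3P[con bip free].
apply: (@leq_bigmax_cond _ _ (fun G => #|edges G|)); rewrite con bip /=.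
apply: contra free => /path_of_contains[q gq sq].
have -> : n = size (take n q) by rewrite size_takel // sq.
by apply: contains_path; exact: gpath_take.
Qed.

Unset Implicit Arguments.

Theorem theorem1p5 (k a b : nat) (hk : 3 <= k) (hka : k <= a) (hab : a <= b) :
  ex_bc a b (path_graph (2 * k)) = ex_bc a b (path_graph (2 * k - 1)) /\
  ex_bc a b (path_graph (2 * k - 1)) = (k - 2) * (b - 1) + a.
Proof.
have up := ex_bc_upper hk hka hab.
have low := ex_bc_lower hk hka hab.
have mono := ex_bc_mono a b (leq_subr 1 (2 * k)).
by split; apply/eqP; rewrite eqn_leq ?mono ?low ?(leq_trans up low) ?(leq_trans mono up).
Qed.
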